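(* Any subgroup $H$ of $PL_o(I)$ which admits a tall tower contains a subgroup isomorphic to $(\mathbf{Z}\wr)^{\infty}$.
   Context: $PL_o(I)$ is the group of orientation-preserving piecewise-linear homeomorphisms of $I=[0,1]$ with finitely many breaks in slope, acting on the right. An orbital of $g$ is a connected component of the set of points moved by $g$. A signed orbital of $H$ is a pair $(A,g)$, $g\in H$, $A$ an orbital of $g$. A tower of $H$ is a set of signed orbitals of $H$ with pairwise distinct orbitals which are pairwise comparable under inclusion, ordered by inclusion of orbitals. A tower $T$ is tall if there is an order-preserving injection from $\mathbf{N}$ (positive integers) into $T$, i.e. $T$ contains signed orbitals $(A_1,g_1),(A_2,g_2),\ldots$ with $A_1\subsetneq A_2\subsetneq\cdots$. Restricted wreath product: $A\wr\mathbf{Z}=(\bigoplus_{i\in\mathbf{Z}}A)\rtimes\mathbf{Z}$. Let $W_1=\mathbf{Z}$, $W_{k+1}=W_k\wr\mathbf{Z}$ with $W_k$ embedded as the index-$0$ summand of the base; $(\mathbf{Z}\wr)^{\infty}=\ldots((\mathbf{Z}\wr\mathbf{Z})\wr\mathbf{Z})\wr\ldots$ is the ascending union of the $W_k$. *)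

(* Defs.v *)
From Stdlib Require Import Reals ZArith.
Open Scope R_scope.

Definition unitI (x : R) : Prop := 0 <= x <= 1.

(* Elements of PL_o(I) are represented as functions R -> R that are the
   identity outside I = [0,1], so equality of elements is equality of
   functions. *)
Definition piecewise_linear (f : R -> R) : Prop :=
  exists (n : nat) (x a b : nat -> R),
    x O = 0 /\ x n = 1 /\
    (forall i, (i < n)%nat -> x i < x (S i)) /\
    (forall i t, (i < n)%nat -> x i <= t <= x (S i) -> f t = a i * t + b i).

Definition PLo (f : R -> R) : Prop :=
  (forall x, ~ unitI x -> f x = x) /\
  f 0 = 0 /\ f 1 = 1 /\
  (forall x y, unitI x -> unitI y -> x < y -> f x < f y) /\
  (forall y, unitI y -> exists x, unitI x /\ f x = y) /\
  (forall x, unitI x -> continuity_pt f x) /\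
  piecewise_linear f.

(* Right action: x.(g h) = (x.g).h, i.e. g h is "first g, then h". *)
Definition plmul (g h : R -> R) : R -> R := fun x => h (g x).

Definition is_subgroup_PLo (H : (R -> R) -> Prop) : Prop :=
  (forall g, H g -> PLo g) /\
  H (fun x => x) /\
  (forall g h, H g -> H h -> H (plmul g h)) /\
  (forall g, H g -> exists h, H h /\ plmul g h = (fun x => x)
                                /\ plmul h g = (fun x => x)).

Definition moved (g : R -> R) (x : R) : Prop := unitI x /\ g x <> x.

(* connected subsets of R = convex subsets *)
Definition connectedR (A : R -> Prop) : Prop :=
  forall x y z, A x -> A y -> x <= z <= y -> A z.

Definition subsetR (A B : R -> Prop) : Prop := forall x, A x -> B x.

Definition orbital (g : R -> R) (A : R -> Prop) : Prop :=
  (exists x, A x) /\ subsetR A (moved g) /\ connectedR A /\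
  (forall B, connectedR B -> subsetR B (moved g) -> subsetR A B -> subsetR B A).

Definition signed_orbital (H : (R -> R) -> Prop)
  (p : (R -> Prop) * (R -> R)) : Prop :=
  H (snd p) /\ orbital (snd p) (fst p).

Definition tower (H : (R -> R) -> Prop)
  (T : (R -> Prop) * (R -> R) -> Prop) : Prop :=
  (forall p, T p -> signed_orbital H p) /\
  (forall p q, T p -> T q -> p <> q ->
     ~ (forall x, fst p x <-> fst q x)) /\
  (forall p q, T p -> T q ->
     subsetR (fst p) (fst q) \/ subsetR (fst q) (fst p)).

(* order-preserving injection from the positive integers (indexed here by nat
   via n |-> n+1) into T, ordered by inclusion of orbitals *)
Definition tall (T : (R -> Prop) * (R -> R) -> Prop) : Prop :=
  exists s : nat -> (R -> Prop) * (R -> R),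
    (forall n, T (s n)) /\
    (forall n m, s n = s m -> n = m) /\
    (forall n m, (n < m)%nat -> subsetR (fst (s n)) (fst (s m))).

Definition admits_tall_tower (H : (R -> R) -> Prop) : Prop :=
  exists T, tower H T /\ tall T.

(* A group given by raw operations on a carrier together with the predicate
   of valid elements (needed for finite support in restricted wreath products). *)
Record RawGroup := {
  car : Type;
  valid : car -> Prop;
  one : car;
  mul : car -> car -> car
}.

Definition Zgroup : RawGroup :=
  {| car := Z; valid := fun _ => True; one := 0%Z; mul := Z.add |}.

(* Restricted wreath product A wr Z = (bigoplus_{i in Z} A) x| Z,
   elements (f, n) with f : Z -> A finitely supported;
   (f, n)(g, m) = (f * (n.g), n + m), where (n.g)(i) = g(i - n). *)
Definition wrZ (A : RawGroup) : RawGroup :=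
  {| car := ((Z -> car A) * Z)%type;
     valid := fun p => (forall i, valid A (fst p i)) /\
                       exists N : Z, forall i, (N < Z.abs i)%Z -> fst p i = one A;
     one := (fun _ => one A, 0%Z);
     mul := fun p q => (fun i => mul A (fst p i) (fst q (i - snd p)%Z),
                        (snd p + snd q)%Z) |}.

(* W k is W_{k+1} of the paper: W_1 = Z, W_{k+1} = W_k wr Z. *)
Fixpoint W (k : nat) : RawGroup :=
  match k with
  | O => Zgroup
  | S k' => wrZ (W k')
  end.

Definition embW (k : nat) (a : car (W k)) : car (W (S k)) :=
  (fun i : Z => if Z.eq_dec i 0 then a else one (W k), 0%Z).

(* H contains a subgroup isomorphic to the ascending union (Z wr)^infty of the
   W_k: equivalently (direct limit), a compatible family of injective
   homomorphisms phi_k : W_k -> H. *)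
Definition contains_Zwr_infty (H : (R -> R) -> Prop) : Prop :=
  exists phi : forall k : nat, car (W k) -> (R -> R),
    (forall k x, valid (W k) x -> H (phi k x)) /\
    (forall k x y, valid (W k) x -> valid (W k) y ->
        phi k (mul (W k) x y) = plmul (phi k x) (phi k y)) /\
    (forall k x y, valid (W k) x -> valid (W k) y ->
        phi k x = phi k y -> x = y) /\
    (forall k x, valid (W k) x -> phi (S k) (embW k x) = phi k x).

(* Main.v *)
Require Import Defs.
From Stdlib Require Import Reals ZArith.
From Stdlib Require Import Lra Lia List Classical ClassicalEpsilon FunctionalExtensionality.

(* It suffices to find x_0, x_1, ... in H such that every nontrivial power of x_(n+1)
   displaces the support of x_n: then W_k acts with x_k as top generator.
   Let K be generated by the elements of a tall tower. Affine germs at a common fixed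
   point commute, and this forces the subgroup G of elements of K that are trivial near
   the fixed points of K to act without fixed points on the component U of the support
   of K containing the tower, each of its elements having support compact in U.
   The remaining difficulty is the behaviour of elements of G outside U. The support of
   a given element meets finitely many components; take a subgroup Z, still without fixed
   point in U, that is nontrivial on as few of them as possible. If Z had a fixed point
   in one of these components, commutators [a, b^w], with w trivial on supp(a) and
   supp(b) in U but moving supp(b) off supp(a) in that component, would give a smaller
   choice. So Z has no fixed point on any of them, and any compact subset can be displaced
   by one element of Z, on all components simultaneously. *)

(** * Groups of increasing maps with affine germs *)

Definition inv2 (f f' : R -> R) : Prop :=
  (forall x, f' (f x) = x) /\ (forall x, f (f' x) = x).

(** Piecewise linearity is kept only as an affine germ on each side of every point [e]: [c = 1] is
    the right side, [c = - 1] the left. *)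
Record plmap (f : R -> R) : Prop := {
  pl_inc : forall x y, x < y -> f x < f y;
  pl_id : forall x, x <= 0 \/ 1 <= x -> f x = x;
  pl_germ : forall e c, c = 1 \/ c = - 1 -> exists d a b, 0 < d /\
    forall t, 0 <= c * (t - e) <= d -> f t = a * t + b }.

(** Closure under composition is the same condition as closure under [plmul], whose factors come in
    the other order. *)
Record grp (Y : (R -> R) -> Prop) : Prop := {
  grp_id : Y (fun x => x);
  grp_mul : forall f g, Y f -> Y g -> Y (fun x => f (g x));
  grp_inv : forall f, Y f -> exists f', Y f' /\ inv2 f f';
  grp_pl : forall f, Y f -> plmap f }.

Definition fixedby (Y : (R -> R) -> Prop) (e : R) : Prop := forall f, Y f -> f e = e.

(* [(v, w)] is a connected component of the support of [Y]. *)
Definition gap (Y : (R -> R) -> Prop) (v w : R) : Prop :=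
  v < w /\ fixedby Y v /\ fixedby Y w /\ forall e, v < e < w -> ~ fixedby Y e.

Lemma inv2_sym f f' : inv2 f f' -> inv2 f' f.
Proof. intros [A B]; split; auto. Qed.

Lemma inv2_eq f f' g : inv2 f f' -> inv2 f g -> f' = g.
Proof.
  intros [A B] [C D]. extensionality x. rewrite <- (D x) at 1. apply A.
Qed.

Lemma grp_inv_in Y f f' : grp Y -> Y f -> inv2 f f' -> Y f'.
Proof.
  intros G Yf I. destruct (grp_inv _ G f Yf) as [h [Yh Ih]].
  rewrite (inv2_eq _ _ _ I Ih). exact Yh.
Qed.

Lemma pl_le f x y : plmap f -> x <= y -> f x <= f y.
Proof. intros P [L | ->]; [ left; apply (pl_inc _ P); auto | right; auto ]. Qed.

Lemma pl_lt_inv f x y : plmap f -> f x < f y -> x < y.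
Proof.
  intros P L. destruct (Rlt_le_dec x y) as [|K]; auto.
  apply (pl_le f) in K; auto. lra.
Qed.

Lemma pl_le_inv f x y : plmap f -> f x <= f y -> x <= y.
Proof.
  intros P L. destruct (Rlt_le_dec y x) as [K|]; auto.
  apply (pl_inc f P) in K. lra.
Qed.

Lemma pl_inj f x y : plmap f -> f x = f y -> x = y.
Proof. intros P E. apply Rle_antisym; apply (pl_le_inv f); auto; lra. Qed.

Lemma inv2_fix f f' x : inv2 f f' -> f x = x -> f' x = x.
Proof. intros [A _] E. rewrite <- E at 1. apply A. Qed.

Lemma moved_range f x : plmap f -> f x <> x -> 0 < x < 1.
Proof.
  intros P N. destruct (Rlt_le_dec 0 x); destruct (Rlt_le_dec x 1); try lra;
  exfalso; apply N; apply (pl_id _ P); lra.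
Qed.

(** * Fixed points, gaps and orbits *)

Lemma sup_fixed f f' (P : R -> Prop) s : plmap f -> inv2 f f' ->
  (forall p, P p -> f p = p) -> is_lub P s -> f s = s.
Proof.
  intros Pf I FP [U L]. apply Rle_antisym.
  (* Monotonicity replaces continuity: if [f s] exceeded [s], then [f' s] would be an upper bound
     smaller than [s]. *)
  - destruct (Rlt_le_dec s (f s)) as [K|]; auto. exfalso.
    assert (K2 : f' s < s).
    { apply (pl_lt_inv f); auto. rewrite (proj2 I). exact K. }
    assert (s <= f' s); [ | lra]. apply L. intros p Pp.
    destruct (Rlt_le_dec (f' s) p) as [Q|]; auto.
    apply (pl_inc _ Pf) in Q. rewrite (proj2 I), (FP p Pp) in Q.
    specialize (U p Pp). lra.
  - apply L. intros p Pp. rewrite <- (FP p Pp). apply pl_le; auto.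
Qed.

Lemma inf_fixed f f' (P : R -> Prop) s : plmap f -> inv2 f f' ->
  (forall p, P p -> f p = p) -> is_lub (fun x => P (- x)) (- s) -> f s = s.
Proof.
  intros Pf I FP [U L]. apply Rle_antisym.
  - assert (- s <= - f s); [|lra]. apply L. intros p Pp.
    specialize (U p Pp). assert (f s <= f (- p)) by (apply pl_le; auto; lra).
    rewrite (FP _ Pp) in H. lra.
  - destruct (Rlt_le_dec (f s) s) as [K|]; auto. exfalso.
    assert (K2 : s < f' s).
    { apply (pl_lt_inv f); auto. rewrite (proj2 I). exact K. }
    assert (- s <= - f' s); [ | lra]. apply L. intros p Pp.
    destruct (Rlt_le_dec (- p) (f' s)) as [Q|]; [|lra].
    apply (pl_inc _ Pf) in Q. rewrite (proj2 I), (FP _ Pp) in Q.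
    specialize (U p Pp). lra.
Qed.

(** The ends are the last fixed point left of [p] and the first one right of it. A family of maps is
    allowed instead of a group, so that the lemma also yields the orbitals of a single map. *)
Lemma gap_exists (Y : (R -> R) -> Prop) p :
  (forall f, Y f -> plmap f /\ exists f', inv2 f f') -> ~ fixedby Y p ->
  exists v w, v < p < w /\ 0 <= v /\ w <= 1 /\ gap Y v w.
Proof.
  intros HY Np.
  assert (F0 : fixedby Y 0) by (intros f Yf; apply (pl_id _ (proj1 (HY f Yf))); lra).
  assert (F1 : fixedby Y 1) by (intros f Yf; apply (pl_id _ (proj1 (HY f Yf))); lra).
  assert (Rp : 0 < p < 1).
  { apply not_all_ex_not in Np as [f Np]. apply imply_to_and in Np as [Yf Np].
    apply (moved_range f); auto. apply HY; auto. }
  destruct (completeness (fun z => z <= p /\ fixedby Y z)) as [v Lv].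
  { exists p. intros z [Q _]; auto. }
  { exists 0. split; auto; lra. }
  destruct (completeness (fun z => p <= - z /\ fixedby Y (- z))) as [w' Lw].
  { exists (- p). intros z [Q _]; lra. }
  { exists (- 1). replace (- - 1) with 1 by lra. split; auto; lra. }
  set (w := - w').
  assert (Fv : fixedby Y v).
  { intros f Yf. destruct (HY f Yf) as [Pf [f' I]].
    apply (sup_fixed f f' (fun z => z <= p /\ fixedby Y z)); auto.
    intros q [_ Fq]. apply Fq; auto. }
  assert (Fw : fixedby Y w).
  { intros f Yf. destruct (HY f Yf) as [Pf [f' I]].
    apply (inf_fixed f f' (fun z => p <= z /\ fixedby Y z)); auto.
    - intros q [_ Fq]. apply Fq; auto.
    - unfold w. rewrite Ropp_involutive. exact Lw. }
  assert (v <= p) by (apply Lv; intros z [Q _]; auto).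
  assert (w' <= - p) by (apply Lw; intros z [Q _]; lra).
  assert (v <> p) by (intros ->; auto).
  assert (w <> p) by (intros E; rewrite E in Fw; auto).
  assert (0 <= v) by (apply Lv; split; auto; lra).
  assert (- 1 <= w') by (apply Lw; replace (- - 1) with 1 by lra; split; auto; lra).
  exists v, w. unfold w in *. repeat split; auto; try lra.
  intros e Re Fe. destruct (Rlt_le_dec e p).
  - assert (e <= v) by (apply Lv; split; auto; lra). lra.
  - assert (- e <= w') by (apply Lw; rewrite Ropp_involutive; split; auto; lra). lra.
Qed.

Lemma grp_gap Y p : grp Y -> ~ fixedby Y p ->
  exists v w, v < p < w /\ gap Y v w.
Proof.
  intros G N. destruct (gap_exists Y p) as [v [w [A [_ [_ B]]]]]; eauto.
  intros f Yf. split. apply (grp_pl _ G); auto.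
  destruct (grp_inv _ G f Yf) as [f' [_ I]]; eauto.
Qed.

Lemma gap_stable Y v w y t : grp Y -> gap Y v w -> Y y -> v < t < w -> v < y t < w.
Proof.
  intros G [_ [Fv [Fw _]]] Yy [A B].
  rewrite <- (Fv y Yy), <- (Fw y Yy). split; apply (pl_inc _ (grp_pl _ G y Yy)); auto.
Qed.

(** Otherwise the supremum of the orbit of [e] would be a fixed point inside the gap. *)
Lemma orbit_right Y v w e c : grp Y -> gap Y v w -> v < e < w -> c < w ->
  exists y, Y y /\ c < y e.
Proof.
  intros G GP He Hc. apply NNPP. intros N.
  assert (B : forall y, Y y -> y e <= c).
  { intros y Yy. destruct (Rlt_le_dec c (y e)); auto. exfalso. eauto. }
  destruct (completeness (fun z => exists y, Y y /\ z = y e)) as [s [U L]].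
  { exists c. intros z [y [Yy ->]]; auto. }
  { exists e. exists (fun x => x). split; auto. apply (grp_id _ G). }
  assert (e <= s) by (apply U; exists (fun x => x); split; auto; apply (grp_id _ G)).
  assert (s <= c) by (apply L; intros z [y [Yy ->]]; auto).
  assert (K : forall y, Y y -> s <= y s).
  { intros y Yy. apply L. intros z [k [Yk ->]].
    destruct (grp_inv _ G y Yy) as [y' [Yy' I]].
    rewrite <- (proj2 I (k e)). apply pl_le. apply (grp_pl _ G); auto.
    apply U. exists (fun x => y' (k x)). split; auto. apply (grp_mul _ G); auto. }
  apply (proj2 (proj2 (proj2 GP)) s). lra.
  intros y Yy. destruct (grp_inv _ G y Yy) as [y' [Yy' I]].
  apply Rle_antisym; auto. rewrite <- (proj2 I s) at 2.
  apply pl_le; auto. apply (grp_pl _ G); auto.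
Qed.

Lemma orbit_left Y v w e c : grp Y -> gap Y v w -> v < e < w -> v < c ->
  exists y, Y y /\ y e < c.
Proof.
  intros G GP He Hc. destruct (Rlt_le_dec e c) as [K|K].
  { exists (fun x => x). split; auto. apply (grp_id _ G). }
  destruct (orbit_right Y v w c e) as [y [Yy L]]; auto; try lra.
  destruct (grp_inv _ G y Yy) as [y' [Yy' I]]. exists y'. split; auto.
  apply (pl_lt_inv y). apply (grp_pl _ G); auto. rewrite (proj2 I); auto.
Qed.

(** * Normal subgroups and the core *)

Definition normal (Z Y : (R -> R) -> Prop) : Prop :=
  forall y y' z, Y y -> Y y' -> inv2 y y' -> Z z -> Z (fun x => y (z (y' x))).

Lemma normal_fixed Z Y y e : grp Y -> normal Z Y -> Y y -> fixedby Z e -> fixedby Z (y e).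
Proof.
  intros G N Yy F z Zz. destruct (grp_inv _ G y Yy) as [y' [Yy' I]].
  assert (E := F _ (N y' y z Yy' Yy (inv2_sym _ _ I) Zz)). cbv beta in E.
  rewrite <- E at 2. rewrite (proj2 I). reflexivity.
Qed.

(* The elements of [Y] whose support is bounded away from the points fixed by [Y];
   this stands in for the derived subgroup, which it contains because affine germs
   at a common fixed point commute. *)
Definition core (Y : (R -> R) -> Prop) (y : R -> R) : Prop :=
  Y y /\ forall e, fixedby Y e -> exists d, 0 < d /\ forall t, e - d < t < e + d -> y t = t.

Lemma core_grp Y : grp Y -> grp (core Y).
Proof.
  intros G. constructor.
  - split. apply (grp_id _ G). intros. exists 1. split; auto; lra.
  - intros f g [Yf Cf] [Yg Cg]. split. apply (grp_mul _ G); auto.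
    intros e Fe. destruct (Cf e Fe) as [d [D1 D2]]. destruct (Cg e Fe) as [d' [D1' D2']].
    exists (Rmin d d'). split. apply Rmin_pos; auto.
    intros t Ht. assert (A := Rmin_l d d'). assert (B := Rmin_r d d').
    rewrite D2'; [apply D2|]; lra.
  - intros f [Yf Cf]. destruct (grp_inv _ G f Yf) as [f' [Yf' I]].
    exists f'. split; auto. split; auto. intros e Fe.
    destruct (Cf e Fe) as [d [D1 D2]]. exists d. split; auto. intros t Ht.
    apply (inv2_fix f); auto.
  - intros f [Yf _]. apply (grp_pl _ G); auto.
Qed.

Lemma core_normal Y : grp Y -> normal (core Y) Y.
Proof.
  intros G y y' z Yy Yy' I [Yz Cz]. split.
  - apply (grp_mul _ G y (fun x => z (y' x))); auto. apply (grp_mul _ G); auto.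
  - intros e Fe. destruct (Cz e Fe) as [d [D1 D2]].
    assert (P := grp_pl _ G y Yy).
    assert (A : y (e - d) < e) by (rewrite <- (Fe y Yy) at 2; apply (pl_inc _ P); lra).
    assert (B : e < y (e + d)) by (rewrite <- (Fe y Yy) at 1; apply (pl_inc _ P); lra).
    exists (Rmin (e - y (e - d)) (y (e + d) - e)). split. apply Rmin_pos; lra.
    intros t Ht. assert (M1 := Rmin_l (e - y (e - d)) (y (e + d) - e)).
    assert (M2 := Rmin_r (e - y (e - d)) (y (e + d) - e)).
    rewrite D2. apply (proj2 I).
    split; apply (pl_lt_inv y); auto; rewrite (proj2 I); lra.
Qed.

Lemma affine_fix_slope f e c d a b : plmap f -> f e = e -> c = 1 \/ c = - 1 -> 0 < d ->
  (forall t, 0 <= c * (t - e) <= d -> f t = a * t + b) ->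
  0 < a /\ forall t, 0 <= c * (t - e) <= d -> f t = e + a * (t - e).
Proof.
  intros P Fe Hc D L. assert (E := L e ltac:(lra)).
  assert (Q : 0 < a * d).
  { assert (K := L (e + c * d)). destruct Hc as [->| ->].
    - assert (f e < f (e + 1 * d)) by (apply (pl_inc _ P); lra). lra.
    - assert (f (e + - 1 * d) < f e) by (apply (pl_inc _ P); lra). lra. }
  split.
  - apply Rmult_lt_reg_r with d; lra.
  - intros t Ht. rewrite L by lra. lra.
Qed.

Lemma germs_commute u v e c : plmap u -> plmap v -> u e = e -> v e = e ->
  c = 1 \/ c = - 1 ->
  exists d, 0 < d /\ forall t, 0 <= c * (t - e) <= d -> u (v t) = v (u t).
Proof.
  intros Pu Pv Fu Fv Hc.
  destruct (pl_germ _ Pu e c Hc) as [d1 [a1 [b1 [D1 L1]]]].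
  destruct (pl_germ _ Pv e c Hc) as [d2 [a2 [b2 [D2 L2]]]].
  destruct (affine_fix_slope u e c d1 a1 b1) as [A1 K1]; auto.
  destruct (affine_fix_slope v e c d2 a2 b2) as [A2 K2]; auto.
  (* Small enough that each map carries the interval into the domain where the other is affine. *)
  set (d := Rmin (Rmin d1 d2) (Rmin (d1 / a2) (d2 / a1))).
  assert (M1 : d <= d1) by (eapply Rle_trans; [apply Rmin_l | apply Rmin_l]).
  assert (M2 : d <= d2) by (eapply Rle_trans; [apply Rmin_l | apply Rmin_r]).
  assert (M3 : d <= d1 / a2) by (eapply Rle_trans; [apply Rmin_r | apply Rmin_l]).
  assert (M4 : d <= d2 / a1) by (eapply Rle_trans; [apply Rmin_r | apply Rmin_r]).
  assert (M5 : a2 * d <= d1).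
  { apply Rmult_le_compat_r with (r := a2) in M3; [|lra]. field_simplify in M3; lra. }
  assert (M6 : a1 * d <= d2).
  { apply Rmult_le_compat_r with (r := a1) in M4; [|lra]. field_simplify in M4; lra. }
  exists d. split.
  { unfold d. repeat apply Rmin_pos; auto; apply Rdiv_lt_0_compat; auto. }
  intros t Ht. rewrite (K2 t), (K1 t) by lra.
  assert (0 <= a2 * (c * (t - e)) <= a2 * d)
    by (split; [apply Rmult_le_pos | apply Rmult_le_compat_l]; lra).
  assert (0 <= a1 * (c * (t - e)) <= a1 * d)
    by (split; [apply Rmult_le_pos | apply Rmult_le_compat_l]; lra).
  rewrite K1, K2; [ring | |].
  - replace (c * (e + a1 * (t - e) - e)) with (a1 * (c * (t - e))) by ring. lra.
  - replace (c * (e + a2 * (t - e) - e)) with (a2 * (c * (t - e))) by ring. lra.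
Qed.

(** With [s = u' (v' t)], the commutator sends [t = v (u s)] to [u (v s)]; these agree when [s] is
    near [e], where the germs commute. *)
Lemma core_commutator Y u v u' v' : grp Y -> Y u -> Y v -> inv2 u u' -> inv2 v v' ->
  core Y (fun x => u (v (u' (v' x)))).
Proof.
  intros G Yu Yv Iu Iv.
  assert (Yu' := grp_inv_in Y u u' G Yu Iu). assert (Yv' := grp_inv_in Y v v' G Yv Iv).
  assert (Pu := grp_pl _ G u Yu). assert (Pv := grp_pl _ G v Yv).
  split.
  { apply (grp_mul _ G u (fun x => v (u' (v' x)))); auto.
    apply (grp_mul _ G v (fun x => u' (v' x))); auto. apply (grp_mul _ G); auto. }
  intros e Fe.
  destruct (germs_commute u v e 1) as [d1 [D1 C1]]; auto.
  destruct (germs_commute u v e (- 1)) as [d2 [D2 C2]]; auto.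
  assert (Q : forall x, x < e + d1 -> e - d2 < x -> u (v x) = v (u x)).
  { intros x X1 X2. destruct (Rlt_le_dec x e); [apply C2 | apply C1]; lra. }
  assert (E : v (u e) = e) by (rewrite (Fe u), (Fe v); auto).
  assert (A : v (u (e - d2)) < e).
  { rewrite <- E at 2. apply (pl_inc _ Pv), (pl_inc _ Pu). lra. }
  assert (B : e < v (u (e + d1))).
  { rewrite <- E at 1. apply (pl_inc _ Pv), (pl_inc _ Pu). lra. }
  exists (Rmin (e - v (u (e - d2))) (v (u (e + d1)) - e)). split. apply Rmin_pos; lra.
  intros t Ht. assert (M1 := Rmin_l (e - v (u (e - d2))) (v (u (e + d1)) - e)).
  assert (M2 := Rmin_r (e - v (u (e - d2))) (v (u (e + d1)) - e)).
  assert (T : v (u (u' (v' t))) = t) by (rewrite (proj2 Iu), (proj2 Iv); auto).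
  rewrite Q; auto; apply (pl_lt_inv u); auto; apply (pl_lt_inv v); auto; lra.
Qed.

(** * Supports inside a gap, displacement and finite covers *)

Definition trivial_on (v w : R) (y : R -> R) : Prop := forall t, v < t < w -> y t = t.

Definition supp_in (v w l r : R) (y : R -> R) : Prop :=
  forall t, v < t < w -> y t <> t -> l <= t <= r.

Definition inner (v w : R) (y : R -> R) : Prop :=
  exists l r, v < l /\ l <= r /\ r < w /\ supp_in v w l r y.

Lemma supp_in_inv v w l r y y' : inv2 y y' -> supp_in v w l r y -> supp_in v w l r y'.
Proof.
  intros I S t Ht N. apply S; auto. intros E. apply N. apply (inv2_fix y); auto.
Qed.

Lemma supp_in_fix v w l r y t : supp_in v w l r y -> v < t < w -> t < l \/ r < t -> y t = t.
Proof. intros S Ht K. apply NNPP. intros N. specialize (S t Ht N). lra. Qed.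

Lemma core_inner Y v w y : core Y y -> gap Y v w -> inner v w y.
Proof.
  intros [Yy C] [L [Fv [Fw _]]].
  destruct (C v Fv) as [d [D1 D2]]. destruct (C w Fw) as [d' [D1' D2']].
  (* The midpoint keeps the two ends in order when [d] or [d'] is large. *)
  set (m := (v + w) / 2).
  exists (Rmin m (v + d / 2)), (Rmax m (w - d' / 2)).
  assert (A1 := Rmin_l m (v + d / 2)). assert (A2 := Rmax_l m (w - d' / 2)).
  repeat split.
  - apply Rmin_glb_lt; unfold m; lra.
  - lra.
  - apply Rmax_lub_lt; unfold m; lra.
  - destruct (Rlt_le_dec t (Rmin m (v + d / 2))) as [K|]; auto. exfalso. apply H0.
    assert (A3 := Rmin_r m (v + d / 2)). apply D2. lra.
  - destruct (Rlt_le_dec (Rmax m (w - d' / 2)) t) as [K|]; auto. exfalso. apply H0.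
    assert (A3 := Rmax_r m (w - d' / 2)). apply D2'. lra.
Qed.

(** Take [u] moving [e] and [y] pushing [e] beyond the support of [u]. As [u] fixes [y e], the
    commutator of [u'] and [y'] sends [e] to [u' e]. *)
Lemma commutator_moves Y v w e : grp Y -> gap Y v w -> (forall y, Y y -> inner v w y) ->
  v < e < w -> exists a b a' b', Y a /\ Y b /\ inv2 a a' /\ inv2 b b' /\
    a (b (a' (b' e))) <> e.
Proof.
  intros G GP In He.
  assert (N := proj2 (proj2 (proj2 GP)) e He).
  apply not_all_ex_not in N as [u N]. apply imply_to_and in N as [Yu Nu].
  destruct (In u Yu) as [l [r [L1 [L2 [L3 S]]]]].
  destruct (orbit_right Y v w e r) as [y [Yy Ly]]; auto.
  destruct (grp_inv _ G u Yu) as [u' [Yu' Iu]].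
  destruct (grp_inv _ G y Yy) as [y' [Yy' Iy]].
  exists u', y', u, y. split; [|split; [|split; [|split]]]; auto using inv2_sym.
  rewrite (supp_in_fix v w l r u (y e)); auto; [|apply (gap_stable Y); auto].
  rewrite (proj1 Iy). intros E. apply Nu. rewrite <- E at 1. apply (proj2 Iu).
Qed.

Lemma core_gap Y v w : grp Y -> gap Y v w -> (forall y, Y y -> inner v w y) ->
  gap (core Y) v w.
Proof.
  intros G GP In. destruct GP as [L [Fv [Fw N]]].
  split; [|split; [|split]]; auto.
  - intros y [Yy _]. apply Fv; auto.
  - intros y [Yy _]. apply Fw; auto.
  - intros e He F.
    destruct (commutator_moves Y v w e) as [a [b [a' [b' [Ya [Yb [Ia [Ib K]]]]]]]]; auto.
    { repeat split; auto. }
    apply K. apply (F _ (core_commutator Y a b a' b' G Ya Yb Ia Ib)).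
Qed.

(* If [w1] pushes the first interval off itself and [w2] does the same for enlarged
   copies of the others, then [w1^-1 w2] or [w2 w1] displaces all of them. *)
Lemma displace Z S : grp Z -> forall F : R * R -> R * R,
  (forall V, In V S -> gap Z (fst V) (snd V) /\ fst V < fst (F V) /\
     fst (F V) <= snd (F V) /\ snd (F V) < snd V) ->
  exists w, Z w /\ forall V, In V S ->
    snd (F V) < w (fst (F V)) \/ w (snd (F V)) < fst (F V).
Proof.
  intros G. induction S as [|V S IH]; intros F HF.
  { exists (fun x => x). split. apply (grp_id _ G). intros V []. }
  destruct (HF V (or_introl eq_refl)) as [GV [F1 [F2 F3]]].
  destruct (orbit_right Z (fst V) (snd V) (fst (F V)) (snd (F V))) as [w1 [Zw1 L1]]; auto; try lra.
  assert (P1 := grp_pl _ G w1 Zw1).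
  (* The enlarged interval contains [F V] and its image under [w1], so both products below inherit
     the displacement from [w2]. *)
  destruct (IH (fun V => (Rmin (fst (F V)) (w1 (fst (F V))),
                          Rmax (snd (F V)) (w1 (snd (F V)))))) as [w2 [Zw2 L2]].
  { intros V' HV'. destruct (HF V' (or_intror HV')) as [GV' [F1' [F2' F3']]]. simpl.
    assert (A := gap_stable Z _ _ w1 (fst (F V')) G GV' Zw1 ltac:(lra)).
    assert (B := gap_stable Z _ _ w1 (snd (F V')) G GV' Zw1 ltac:(lra)).
    split; [exact GV'|]. split; [|split].
    - apply Rmin_glb_lt; lra.
    - eapply Rle_trans. apply Rmin_l. eapply Rle_trans; [|apply Rmax_l]. lra.
    - apply Rmax_lub_lt; lra. }
  assert (P2 := grp_pl _ G w2 Zw2).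
  destruct (grp_inv _ G w1 Zw1) as [w1' [Zw1' I1]].
  assert (P1' := grp_pl _ G w1' Zw1').
  (* This comparison decides which of the two products displaces the first interval. *)
  destruct (Rlt_le_dec (w2 (snd (F V))) (w1 (fst (F V)))) as [K|K].
  - exists (fun x => w1' (w2 x)). split. apply (grp_mul _ G); auto.
    intros V' [<-|HV']; cbv beta.
    + right. apply (pl_lt_inv w1); auto. rewrite (proj2 I1). exact K.
    + assert (A := Rmin_l (fst (F V')) (w1 (fst (F V')))).
      assert (A2 := Rmin_r (fst (F V')) (w1 (fst (F V')))).
      assert (B := Rmax_l (snd (F V')) (w1 (snd (F V')))).
      assert (B2 := Rmax_r (snd (F V')) (w1 (snd (F V')))).
      apply (pl_le w2) in A; auto. apply (pl_le w2) in B; auto.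
      destruct (L2 V' HV') as [Q|Q]; simpl in Q; [left|right];
        apply (pl_lt_inv w1); auto; rewrite (proj2 I1); lra.
  - exists (fun x => w2 (w1 x)). split. apply (grp_mul _ G); auto.
    intros V' [<-|HV']; cbv beta.
    + left. assert (L3 := pl_inc _ P2 _ _ L1). lra.
    + assert (A := Rmin_l (fst (F V')) (w1 (fst (F V')))).
      assert (A2 := Rmin_r (fst (F V')) (w1 (fst (F V')))).
      assert (B := Rmax_l (snd (F V')) (w1 (snd (F V')))).
      assert (B2 := Rmax_r (snd (F V')) (w1 (snd (F V')))).
      apply (pl_le w2) in A2; auto. apply (pl_le w2) in B2; auto.
      destruct (L2 V' HV') as [Q|Q]; simpl in Q; [left|right]; lra.
Qed.

(** Compactness as a supremum argument: near a point fixed by [Y] the map [y] is trivial, and any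
    other point has a whole gap as neighbourhood. The bound 2 lies beyond the support. *)
Lemma core_cover Y y : grp Y -> core Y y -> exists L : list (R * R),
  (forall V, In V L -> gap Y (fst V) (snd V)) /\
  forall t, y t <> t -> exists V, In V L /\ fst V < t < snd V.
Proof.
  intros G [Yy C]. assert (Py := grp_pl _ G y Yy).
  set (P := fun x => exists L : list (R * R),
    (forall V, In V L -> gap Y (fst V) (snd V)) /\
    forall t, t <= x -> y t <> t -> exists V, In V L /\ fst V < t < snd V).
  assert (P2 : P 2).
  { destruct (completeness (fun x => x <= 2 /\ P x)) as [s [U Lb]].
    { exists 2. intros x [A _]; auto. }
    { exists 0. split. lra. exists nil. split. intros V [].
      intros t Ht N. apply moved_range in N; auto. lra. }
    assert (Hloc : exists d L, 0 < d /\
      (forall V : R * R, In V L -> gap Y (fst V) (snd V)) /\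
      forall t, s - d < t < s + d -> y t <> t -> exists V, In V L /\ fst V < t < snd V).
    { destruct (classic (fixedby Y s)) as [F|F].
      - destruct (C s F) as [d [D1 D2]]. exists d, nil. split; auto. split. intros V [].
        intros t Ht N. exfalso. auto.
      - destruct (grp_gap Y s G F) as [v [w [Hs GP]]].
        exists (Rmin (s - v) (w - s)), ((v, w) :: nil).
        split. apply Rmin_pos; lra. split.
        + intros V [<-|[]]. exact GP.
        + intros t Ht _. assert (A := Rmin_l (s - v) (w - s)).
          assert (B := Rmin_r (s - v) (w - s)). exists (v, w). simpl. split; auto. lra. }
    destruct Hloc as [d [L0 [D [G0 C0]]]].
    assert (X : exists x, s - d < x /\ P x).
    { apply NNPP. intros N. assert (s <= s - d); [|lra]. apply Lb.
      intros x [_ Px]. destruct (Rlt_le_dec (s - d) x); auto. exfalso. eauto. }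
    destruct X as [x [Hx [L [GL CL]]]].
    assert (Q : P (s + d / 2)).
    { exists (L ++ L0). split.
      - intros V HV. apply in_app_or in HV as [|]; auto.
      - intros t Ht N. destruct (Rle_lt_dec t x) as [K|K].
        + destruct (CL t K N) as [V [HV K2]]. exists V. split; auto. apply in_or_app; auto.
        + destruct (C0 t ltac:(lra) N) as [V [HV K2]]. exists V. split; auto.
          apply in_or_app; auto. }
    destruct (Rle_lt_dec (s + d / 2) 2) as [K|K].
    - assert (s + d / 2 <= s) by (apply U; split; auto). lra.
    - destruct Q as [L' [GL' CL']]. exists L'. split; auto. intros t Ht. apply CL'. lra. }
  destruct P2 as [L [GL CL]]. exists L. split; auto. intros t N. apply CL; auto.
  apply moved_range in N; auto. lra.
Qed.

Lemma grp_trivial_on Z v w : grp Z -> fixedby Z v -> fixedby Z w ->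
  grp (fun z => Z z /\ trivial_on v w z).
Proof.
  intros G Fv Fw. constructor.
  - split. apply (grp_id _ G). intros t _; auto.
  - intros f g [Zf Tf] [Zg Tg]. split. apply (grp_mul _ G); auto.
    intros t Ht. rewrite (Tg t Ht). apply Tf; auto.
  - intros f [Zf Tf]. destruct (grp_inv _ G f Zf) as [f' [Zf' I]]. exists f'.
    split; auto. split; auto. intros t Ht. apply (inv2_fix f); auto.
  - intros f [Zf _]. apply (grp_pl _ G); auto.
Qed.

Lemma least_nat (Q : nat -> Prop) n : Q n -> exists m, Q m /\ forall k, Q k -> (m <= k)%nat.
Proof.
  induction n as [n IH] using (well_founded_induction lt_wf). intros Qn.
  destruct (classic (exists k, (k < n)%nat /\ Q k)) as [[k [L Qk]]|N].
  - eauto.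
  - exists n. split; auto. intros k Qk. destruct (Nat.le_gt_cases n k); auto.
    exfalso. eauto.
Qed.

(** * Full subgroups and the displacing sequence *)

Section Interval.

Variable G : (R -> R) -> Prop.
Variables u1 u2 : R.
Hypothesis GG : grp G.
Hypothesis GU : gap G u1 u2.
Hypothesis GI : forall g, G g -> inner u1 u2 g.

Definition full (Z : (R -> R) -> Prop) : Prop :=
  grp Z /\ (forall z, Z z -> G z) /\ forall e, u1 < e < u2 -> ~ fixedby Z e.

Lemma full_gap Z : full Z -> gap Z u1 u2.
Proof.
  intros [A [B C]]. destruct GU as [L [F1 [F2 _]]]. repeat split; auto; intros z Zz; auto.
Qed.

Lemma full_core Z : full Z -> full (core Z).
Proof.
  intros F. assert (K := full_gap Z F). destruct F as [A [B C]]. split; [|split].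
  - apply core_grp; auto.
  - intros z [Zz _]; auto.
  - apply core_gap; auto.
Qed.

(* The commutators [a, b2], where [b2] agrees with [b] on [(u1, u2)] while its support
   in [(v, w)] is disjoint from that of [a]. *)
Lemma full_trivial_on_gap Y Z v w : full Y -> full Z -> (forall z, Z z -> core Y z) ->
  normal Z Y -> gap Y v w -> (exists e, v < e < w /\ fixedby Z e) ->
  full (fun z => Z z /\ trivial_on v w z).
Proof.
  intros FY FZ ZY N GP [e0 [He0 Fe0]].
  assert (UY := full_gap Y FY). assert (UZ := full_gap Z FZ).
  destruct FY as [GY [SY NY]]. destruct FZ as [GZ [SZ NZ]].
  assert (Fv : fixedby Z v) by (intros z Zz; apply (proj1 (proj2 GP)), ZY, Zz).
  assert (Fw : fixedby Z w) by (intros z Zz; apply (proj1 (proj2 (proj2 GP))), ZY, Zz).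
  split; [|split].
  { apply grp_trivial_on; auto. }
  { intros z [Zz _]; auto. }
  intros e He FE.
  (* [[a, b]] moves [e]; the aim is a commutator with the same value at [e] that is trivial on
     [(v, w)]. *)
  destruct (commutator_moves Z u1 u2 e) as [a [b [a' [b' [Za [Zb [Ia [Ib K]]]]]]]]; auto.
  assert (Za' := grp_inv_in Z a a' GZ Za Ia). assert (Zb' := grp_inv_in Z b b' GZ Zb Ib).
  destruct (core_inner Y v w a) as [la [ra [A1 [A2 [A3 A4]]]]]; auto.
  destruct (core_inner Y v w b) as [lb [rb [B1 [B2 [B3 B4]]]]]; auto.
  (* Translates of [e0], one below the support of [b] and one above that of [a] in [(v, w)]; by
     normality [Z] fixes both. *)
  destruct (orbit_left Y v w e0 lb) as [y0 [Yy0 L0]]; auto.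
  destruct (orbit_right Y v w e0 ra) as [y1 [Yy1 L1]]; auto.
  assert (R0 := gap_stable Y v w y0 e0 GY GP Yy0 He0).
  assert (R1 := gap_stable Y v w y1 e0 GY GP Yy1 He0).
  assert (F0 := normal_fixed Z Y y0 e0 GY N Yy0 Fe0).
  assert (F1 := normal_fixed Z Y y1 e0 GY N Yy1 Fe0).
  set (p := y0 e0) in *. set (q := y1 e0) in *.
  (* [k] carries [p] past [q], and [h] pushes the support of [b] in [(u1, u2)] beyond that of [k].
     Hence [c], the conjugate of [k] by [h], is trivial on that support of [b]; since [h] fixes [p]
     and [q], it still carries [p] past [q]. *)
  destruct (orbit_right Y v w p q) as [k [Yk Lk]]; auto; try lra.
  destruct (GI k (SY k Yk)) as [lk [rk [K1 [K2 [K3 K4]]]]].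
  destruct (GI b (SZ b Zb)) as [lb1 [rb1 [C1 [C2 [C3 C4]]]]].
  destruct (orbit_right Z u1 u2 lb1 rk) as [h [Zh Lh]]; auto; try lra.
  destruct (grp_inv _ GZ h Zh) as [h' [Zh' Ih]].
  destruct (grp_inv _ GY k Yk) as [k' [Yk' Ik]].
  assert (Yh : Y h) by apply (ZY h Zh). assert (Yh' : Y h') by apply (ZY h' Zh').
  set (c := fun x => h' (k (h x))). set (c' := fun x => h' (k' (h x))).
  assert (Yc : Y c) by (apply (grp_mul _ GY h' (fun x => k (h x))); auto; apply (grp_mul _ GY); auto).
  assert (Yc' : Y c') by (apply (grp_mul _ GY h' (fun x => k' (h x))); auto; apply (grp_mul _ GY); auto).
  assert (Ic : inv2 c c').
  { split; intros x; unfold c, c'; rewrite (proj2 Ih); [rewrite (proj1 Ik)|rewrite (proj2 Ik)];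
      apply (proj1 Ih). }
  assert (Pc := grp_pl _ GY c Yc). assert (Pc' := grp_pl _ GY c' Yc').
  assert (cp : q < c p).
  { unfold c. rewrite (F0 h Zh). rewrite <- (F1 h' Zh').
    apply (pl_inc _ (grp_pl _ GZ h' Zh')); auto. }
  assert (cfix : forall t, lb1 <= t < u2 -> c t = t).
  { intros t Ht. unfold c.
    rewrite (supp_in_fix u1 u2 lk rk k (h t)); auto.
    - apply (proj1 Ih).
    - apply (gap_stable Z u1 u2); auto; lra.
    - right. apply Rlt_le_trans with (1 := Lh). apply pl_le; auto. apply (grp_pl _ GZ); auto. lra. }
  assert (conj_eq : forall g, Z g -> supp_in u1 u2 lb1 rb1 g -> forall t, u1 < t < u2 ->
            c (g (c' t)) = g t).
  { intros g Zg Sg t Ht. assert (Hg := gap_stable Z u1 u2 g t GZ UZ Zg Ht).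
    assert (Hlow : forall s, u1 < s < lb1 -> g s = s).
    { intros s Hs. apply (supp_in_fix u1 u2 lb1 rb1); auto; lra. }
    destruct (Rlt_le_dec t lb1) as [Q|Q].
    - assert (Hc := gap_stable Y u1 u2 c' t GY UY Yc' Ht).
      assert (c' t < lb1).
      { rewrite <- (inv2_fix c c' lb1 Ic (cfix lb1 ltac:(lra))). apply (pl_inc _ Pc'); auto. }
      rewrite !Hlow by lra. apply (proj2 Ic).
    - rewrite (inv2_fix c c' t Ic (cfix t ltac:(lra))). apply cfix. split; [|lra].
      destruct (Rlt_le_dec (g t) lb1) as [Q2|]; auto. exfalso.
      assert (E := Hlow (g t) ltac:(lra)).
      apply (pl_inj g) in E; [lra|]. apply (grp_pl _ GZ); auto. }
  assert (C4' := supp_in_inv _ _ _ _ _ _ Ib C4).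
  assert (B4' := supp_in_inv _ _ _ _ _ _ Ib B4).
  assert (A4' := supp_in_inv _ _ _ _ _ _ Ia A4).
  set (b2 := fun x => c (b (c' x))). set (b2' := fun x => c (b' (c' x))).
  assert (Zb2 : Z b2) by (apply N; auto). assert (Zb2' : Z b2') by (apply N; auto).
  (* In [(v, w)] the conjugate by [c] is supported beyond [c p], hence beyond [q]. *)
  assert (conj_triv : forall g, Z g -> supp_in v w lb rb g -> forall t, v < t <= q ->
            c (g (c' t)) = t).
  { intros g Zg Sg t Ht. assert (Hc := gap_stable Y v w c' t GY GP Yc' ltac:(lra)).
    rewrite (supp_in_fix v w lb rb g (c' t)); auto. apply (proj2 Ic).
    left. apply Rle_lt_trans with p; [|lra]. apply (pl_le_inv c); auto.
    rewrite (proj2 Ic). lra. }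
  apply K.
  assert (Q : a (b2 (a' (b2' e))) = e).
  { apply (FE (fun x => a (b2 (a' (b2' x))))). split.
    - apply (grp_mul _ GZ a (fun x => b2 (a' (b2' x)))); auto.
      apply (grp_mul _ GZ b2 (fun x => a' (b2' x))); auto. apply (grp_mul _ GZ); auto.
    (* Above [q] only [b2] acts, up to [q] only [a], and both fix [q]; so their commutator is
       trivial on [(v, w)]. *)
    - intros t Ht. destruct (Rlt_le_dec q t) as [T|T].
      + assert (T2 : q < b2' t) by (rewrite <- (F1 b2' Zb2'); apply (pl_inc _ (grp_pl _ GZ _ Zb2')); auto).
        assert (T3 := gap_stable Y v w b2' t GY GP (proj1 (ZY _ Zb2')) Ht).
        rewrite (supp_in_fix v w la ra a' (b2' t)); auto; [|lra].
        assert (E : b2 (b2' t) = t).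
        { unfold b2, b2'. rewrite (proj1 Ic), (proj2 Ib). apply (proj2 Ic). }
        rewrite E. apply (supp_in_fix v w la ra); auto. lra.
      + assert (E : b2' t = t) by (apply conj_triv; auto; lra). rewrite E.
        assert (T2 : a' t <= q) by (rewrite <- (F1 a' Za'); apply pl_le; auto; apply (grp_pl _ GZ); auto).
        assert (T3 := gap_stable Y v w a' t GY GP (proj1 (ZY _ Za')) Ht).
        assert (E2 : b2 (a' t) = a' t) by (apply conj_triv; auto; lra). rewrite E2.
        apply (proj2 Ia). }
  rewrite <- Q at 2. unfold b2, b2'.
  rewrite (conj_eq b' Zb' C4' e He).
  assert (H1 := gap_stable Z u1 u2 b' e GZ UZ Zb' He).
  assert (H2 := gap_stable Z u1 u2 a' _ GZ UZ Za' H1).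
  rewrite (conj_eq b Zb C4 _ H2). reflexivity.
Qed.

(** [S] is a shortest list of gaps meeting the support of [y] outside which, among the covering
    gaps, some full subgroup of the core is trivial. A fixed point of [Z] in a gap of [S] would
    yield, by [full_trivial_on_gap], a full subgroup trivial there and so a shorter list. *)
Lemma stage Y y : full Y -> core Y y -> exists Z (S : list (R * R)),
  full Z /\ (forall z, Z z -> core Y z) /\ normal Z Y /\
  (forall V, In V S -> gap Y (fst V) (snd V) /\ gap Z (fst V) (snd V)) /\
  (forall v w, gap Y v w -> (exists t, v < t < w /\ y t <> t) ->
     In (v, w) S \/ forall z, Z z -> trivial_on v w z) /\
  (forall V Z', In V S -> full Z' -> (forall z, Z' z -> Z z) ->
     ~ forall z, Z' z -> trivial_on (fst V) (snd V) z).
Proof.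
  intros FY Cy. assert (GY := proj1 FY).
  destruct (core_cover Y y GY Cy) as [L [GL CL]].
  set (Q := fun n => exists (S : list (R * R)) Z0, length S = n /\ incl S L /\ full Z0 /\
     (forall z, Z0 z -> core Y z) /\
     forall V, In V L -> In V S \/ forall z, Z0 z -> trivial_on (fst V) (snd V) z).
  destruct (least_nat Q (length L)) as [m [[S [Z0 [Lm [IL [F0 [C0 T0]]]]]] Min]].
  { exists L, (core Y). split; [|split; [|split; [|split]]]; auto using incl_refl, full_core. }
  (* The largest subgroup of the core trivial on the discarded gaps; it contains [Z0], so it is
     full, and it is normal in [Y]. *)
  set (Z := fun z => core Y z /\ forall V, In V L -> In V S \/ trivial_on (fst V) (snd V) z).
  assert (stab : forall V f t, In V L -> Y f -> fst V < t < snd V -> fst V < f t < snd V).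
  { intros. apply (gap_stable Y); auto. }
  assert (NZ : normal Z Y).
  { intros k k' z Yk Yk' I [Cz Tz]. split. apply core_normal; auto.
    intros V HV. destruct (Tz V HV) as [|T]; auto. right. intros t Ht.
    rewrite T; auto. apply (proj2 I). }
  assert (GZ : grp Z).
  { constructor.
    - split. apply (grp_id _ (core_grp Y GY)). intros V HV. right. intros t _; auto.
    - intros f g [Cf Tf] [Cg Tg]. split. apply (grp_mul _ (core_grp Y GY)); auto.
      intros V HV. destruct (Tf V HV) as [|T]; auto. destruct (Tg V HV) as [|T']; auto.
      right. intros t Ht. rewrite T'; auto.
    - intros f [Cf Tf]. destruct (grp_inv _ (core_grp Y GY) f Cf) as [f' [Cf' I]].
      exists f'. split; auto. split; auto. intros V HV. destruct (Tf V HV) as [|T]; auto.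
      right. intros t Ht. apply (inv2_fix f); auto.
    - intros f [Cf _]. apply (grp_pl _ (core_grp Y GY)); auto. }
  assert (FZ : full Z).
  { split; [|split]; auto.
    - intros z [[Yz _] _]. apply FY; auto.
    - intros e He F. apply (proj2 (proj2 F0) e He). intros z Zz. apply F. split; auto.
      intros V HV. destruct (T0 V HV); auto. }
  assert (MinZ : forall V Z', In V S -> full Z' -> (forall z, Z' z -> Z z) ->
     ~ forall z, Z' z -> trivial_on (fst V) (snd V) z).
  { intros V Z' HV FZ' SZ' T. destruct (in_split V S HV) as [S1 [S2 ES]].
    assert (K : Q (length (S1 ++ S2))).
    { exists (S1 ++ S2), Z'. split; [|split; [|split; [|split]]]; auto.
      - intros V' HV'. apply IL. rewrite ES. apply in_app_or in HV' as [|];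
          apply in_or_app; simpl; auto.
      - intros z Zz. apply SZ'; auto.
      - intros V' HV'. destruct (classic (V' = V)) as [->|NE]; auto.
        destruct (classic (In V' S)) as [I|NI].
        + left. rewrite ES in I. apply in_app_or in I as [|[|]]; try congruence;
            apply in_or_app; auto.
        + right. intros z Zz. destruct (proj2 (SZ' z Zz) V' HV'); tauto. }
    apply Min in K. rewrite <- Lm, ES, !length_app in K. simpl in K. lia. }
  exists Z, S. split; [|split; [|split; [|split; [|split]]]]; auto.
  - intros z [Cz _]; auto.
  - intros V HV. assert (GV := GL V (IL V HV)). split; auto.
    destruct GV as [GV1 [GV2 [GV3 GV4]]]. split; [|split; [|split]]; auto.
    + intros z [[Yz _] _]; auto.
    + intros z [[Yz _] _]; auto.
    + intros e He F.
      apply (MinZ V _ HV (full_trivial_on_gap Y Z (fst V) (snd V) FY FZ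
        (fun z Zz => proj1 Zz) NZ (GL V (IL V HV)) (ex_intro _ e (conj He F)))).
      * intros z [Zz _]; auto.
      * intros z [_ T]; auto.
  - intros v w GP [t [Ht Nt]]. destruct (CL t Nt) as [V [HV Hb]].
    assert (E : V = (v, w)).
    { destruct V as [v' w']. simpl in Hb. destruct (GL _ HV) as [_ [X1 [X2 X3]]].
      destruct GP as [_ [Y1 [Y2 Y3]]]. simpl in *.
      f_equal; apply NNPP; intros NE.
      - destruct (Rlt_le_dec v v') as [K|K]; [apply (Y3 v') | apply (X3 v)]; auto; lra.
      - destruct (Rlt_le_dec w w') as [K|K]; [apply (X3 w) | apply (Y3 w')]; auto; lra. }
    subst V. destruct (classic (In (v, w) S)); auto. right. intros z [_ T].
    destruct (T _ HV); tauto.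
Qed.

(* [Z] acts without fixed points on each gap [V] in [S], every full subgroup of [Z] still
   moves something there, and the support of [x] lies in the intervals [F V]. *)
Definition stable (Z : (R -> R) -> Prop) (S : list (R * R)) (F : R * R -> R * R)
  (x : R -> R) : Prop :=
  full Z /\ Z x /\ In (u1, u2) S /\
  (forall t, x t <> t -> exists V, In V S /\ fst V < t < snd V) /\
  (forall V, In V S -> gap Z (fst V) (snd V) /\
     (forall z, Z z -> inner (fst V) (snd V) z) /\
     (fst V < fst (F V) /\ fst (F V) <= snd (F V) /\ snd (F V) < snd V) /\
     supp_in (fst V) (snd V) (fst (F V)) (snd (F V)) x /\
     forall Z', full Z' -> (forall z, Z' z -> Z z) ->
       ~ forall z, Z' z -> trivial_on (fst V) (snd V) z).

(** Only positive powers occur; [zpow_displaces] deduces the negative ones. *)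
Definition displaces (x' x : R -> R) : Prop :=
  forall n t, x t <> t -> x (Nat.iter (S n) x' t) = Nat.iter (S n) x' t.

Lemma choose_intervals (S : list (R * R)) (P : R * R -> R -> R -> Prop) :
  (forall V, In V S -> exists l r, P V l r) ->
  exists F : R * R -> R * R, forall V, In V S -> P V (fst (F V)) (snd (F V)).
Proof.
  intros H.
  assert (K : forall V, exists p : R * R, In V S -> P V (fst p) (snd p)).
  { intros V. destruct (classic (In V S)) as [I|NI].
    - destruct (H V I) as [l [r Q]]. exists (l, r). auto.
    - exists (0, 0). tauto. }
  exists (fun V => proj1_sig (constructive_indefinite_description _ (K V))).
  intros V. exact (proj2_sig (constructive_indefinite_description _ (K V))).
Qed.

(** [[l, w)] is mapped into [(r, w)], a part of itself, so the first step decides all iterates. *)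
Lemma iter_pushed_right Z v w l r x n t : grp Z -> gap Z v w -> Z x -> v < l -> l <= r ->
  r < x l -> l <= t < w -> r < Nat.iter (S n) x t < w.
Proof.
  intros GZ GP Zx Hl Hr Hx Ht. assert (Px := grp_pl _ GZ x Zx).
  assert (K : forall s, l <= s < w -> r < x s < w).
  { intros s Hs. assert (A := gap_stable Z v w x s GZ GP Zx ltac:(lra)).
    assert (x l <= x s) by (apply pl_le; auto; lra). lra. }
  induction n as [|n IH]; [apply K; auto|].
  apply (K (Nat.iter (S n) x t)). lra.
Qed.

Lemma iter_pushed_left Z v w l r x n t : grp Z -> gap Z v w -> Z x -> r < w -> l <= r ->
  x r < l -> v < t <= r -> v < Nat.iter (S n) x t < l.
Proof.
  intros GZ GP Zx Hl Hr Hx Ht. assert (Px := grp_pl _ GZ x Zx).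
  assert (K : forall s, v < s <= r -> v < x s < l).
  { intros s Hs. assert (A := gap_stable Z v w x s GZ GP Zx ltac:(lra)).
    assert (x s <= x r) by (apply pl_le; auto; lra). lra. }
  induction n as [|n IH]; [apply K; auto|].
  apply (K (Nat.iter (S n) x t)). lra.
Qed.

(* [y1] displaces the support of [x]; the commutator of [y1] with an element [z1] of the
   subgroup given by [stage] still agrees with [y1] there, and is supported where that
   subgroup has no fixed point. *)
Lemma stable_step Z S F x : stable Z S F x -> exists Z' S' F' x',
  stable Z' S' F' x' /\ displaces x' x /\ exists t, x' t <> t.
Proof.
  intros [FZ [Zx [US [Sx HS]]]]. assert (GZ := proj1 FZ).
  destruct (displace (core Z) S (core_grp Z GZ) F) as [y [Cy Dy]].
  { intros V HV. destruct (HS V HV) as [GV [IV [RV _]]]. split; auto. apply core_gap; auto. }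
  assert (Zy := proj1 Cy).
  destruct (stage Z y FZ Cy) as [Z1 [S1 [FZ1 [CZ1 [N1 [GS1 [Split Min]]]]]]].
  assert (GZ1 := proj1 FZ1).
  (* [y] moves a point of [V]; of the two alternatives left by [stage], triviality of [Z1] on [V] is
     excluded by the last clause of [stable]. *)
  assert (SS1 : forall V, In V S -> In V S1).
  { intros V HV. destruct (HS V HV) as [GV [IV [RV [_ MV]]]].
    destruct (Split (fst V) (snd V)) as [I|T]; auto.
    - destruct (Dy V HV); [exists (fst (F V)) | exists (snd (F V))]; split; try intros E; lra.
    - rewrite <- surjective_pairing in I; auto.
    - exfalso. apply (MV Z1); auto. intros z Zz. apply CZ1; auto. }
  (* [D V] contains the support of [y] in [V] and, for [V] in [S], also [F V], where the commutator
     has to agree with [y]. *)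
  destruct (choose_intervals S1 (fun V l r => fst V < l /\ l <= r /\ r < snd V /\
     supp_in (fst V) (snd V) l r y /\ (In V S -> l <= fst (F V) /\ snd (F V) <= r)))
    as [D HD].
  { intros V HV. destruct (core_inner Z (fst V) (snd V) y Cy (proj1 (GS1 V HV)))
      as [l [r [L1 [L2 [L3 L4]]]]].
    destruct (classic (In V S)) as [I|NI].
    - destruct (HS V I) as [_ [_ [RV _]]].
      assert (A1 := Rmin_l l (fst (F V))). assert (A2 := Rmin_r l (fst (F V))).
      assert (B1 := Rmax_l r (snd (F V))). assert (B2 := Rmax_r r (snd (F V))).
      exists (Rmin l (fst (F V))), (Rmax r (snd (F V))).
      repeat split; try lra.
      + apply Rmin_glb_lt; lra.
      + apply Rmax_lub_lt; lra.
      + destruct (L4 t H H0); lra.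
      + destruct (L4 t H H0); lra.
    - exists l, r. repeat split; auto; try tauto; apply L4; auto. }
  destruct (displace Z1 S1 GZ1 D) as [z [Zz Dz]].
  { intros V HV. destruct (HD V HV) as [L1 [L2 [L3 _]]]. split; auto. apply GS1; auto. }
  assert (Pz := grp_pl _ GZ1 z Zz).
  destruct (grp_inv _ GZ y Zy) as [y' [Zy' Iy]].
  destruct (grp_inv _ GZ1 z Zz) as [z' [Zz' Iz]].
  set (x1 := fun t => y (z (y' (z' t)))).
  assert (Zx1 : Z1 x1).
  { apply (grp_mul _ GZ1 (fun t => y (z (y' t))) z'); auto. }
  (* [z'] moves [D V] off itself, hence off the support of [y], so [y'] fixes [z' t]. *)
  assert (agree : forall V t, In V S1 -> fst (D V) <= t <= snd (D V) -> x1 t = y t).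
  { intros V t HV Ht. destruct (HD V HV) as [L1 [L2 [L3 [L4 _]]]]. unfold x1.
    assert (R1 : fst V < z' t < snd V).
    { apply (gap_stable Z1); auto. apply GS1; auto. lra. }
    assert (E : y (z' t) = z' t).
    { apply (supp_in_fix _ _ _ _ _ _ L4); auto.
      destruct (Dz V HV) as [K|K]; [left|right]; apply (pl_lt_inv z); auto;
        rewrite (proj2 Iz); lra. }
    rewrite (inv2_fix y y' _ Iy E), (proj2 Iz). reflexivity. }
  destruct (choose_intervals S1 (fun V l r => (fst V < l /\ l <= r /\ r < snd V) /\
     supp_in (fst V) (snd V) l r x1)) as [F1 HF1].
  { intros V HV. destruct (core_inner Z (fst V) (snd V) x1) as [l [r [L1 [L2 [L3 L4]]]]]; auto.
    - apply GS1; auto.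
    - exists l, r. auto. }
  exists Z1, S1, F1, x1. split; [|split].
  - split; [|split; [|split; [|split]]]; auto.
    + intros t Nt. assert (NF : ~ fixedby Z t).
      { intros Ft. apply Nt. apply Ft. apply CZ1; auto. }
      destruct (grp_gap Z t GZ NF) as [v [w [Ht GP]]].
      (* On a gap of [Z] outside [S1], either [y] is trivial and [x1] reduces to [z z'], or [Z1] is
         trivial and [x1] reduces to [y y']. *)
      destruct (Split v w GP) as [I|T].
      * apply NNPP. intros NE. apply Nt.
        assert (Ty : forall s, v < s < w -> y s = s).
        { intros s Hs. apply NNPP. intros Ns. apply NE. eauto. }
        assert (R1 : v < z' t < w) by (apply (gap_stable Z); auto; apply CZ1; auto).
        unfold x1. rewrite (inv2_fix y y' _ Iy (Ty _ R1)), (proj2 Iz). auto.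
      * exists (v, w). auto.
      * exfalso. apply Nt. unfold x1. rewrite (T z' Zz' t Ht).
        assert (v < y' t < w) by (apply (gap_stable Z); auto).
        rewrite (T z Zz); auto. apply (proj2 Iy).
    + intros V HV. destruct (HF1 V HV) as [A B]. split; [|split; [|split; [|split]]]; auto.
      * apply GS1; auto.
      * intros k Zk. apply (core_inner Z); auto. apply GS1; auto.
  - intros n t Nt. destruct (Sx t Nt) as [V [HV Ht]].
    destruct (HS V HV) as [GV [_ [RV [SV _]]]]. assert (HV1 := SS1 V HV).
    destruct (HD V HV1) as [_ [_ [_ [_ LD]]]]. specialize (LD HV).
    assert (R := SV t Ht Nt). assert (GV1 := proj2 (GS1 V HV1)).
    (* The end of [F V] that [y] pushes across the interval lies in [D V], so [x1] pushes it
       likewise, and so do all its iterates. *)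
    destruct (Dy V HV) as [K|K].
    + rewrite <- (agree V (fst (F V)) HV1 ltac:(lra)) in K.
      assert (Q := iter_pushed_right Z1 (fst V) (snd V) (fst (F V)) (snd (F V)) x1 n t GZ1
        GV1 Zx1 ltac:(lra) ltac:(lra) K ltac:(lra)).
      apply (supp_in_fix _ _ _ _ _ _ SV); lra.
    + rewrite <- (agree V (snd (F V)) HV1 ltac:(lra)) in K.
      assert (Q := iter_pushed_left Z1 (fst V) (snd V) (fst (F V)) (snd (F V)) x1 n t GZ1
        GV1 Zx1 ltac:(lra) ltac:(lra) K ltac:(lra)).
      apply (supp_in_fix _ _ _ _ _ _ SV); lra.
  - destruct (HS _ US) as [_ [_ [RV _]]]. destruct (HD _ (SS1 _ US)) as [_ [_ [_ [_ LD]]]].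
    specialize (LD US). destruct (Dy _ US) as [K|K].
    + exists (fst (F (u1, u2))). rewrite (agree (u1, u2)); auto; lra.
    + exists (snd (F (u1, u2))). rewrite (agree (u1, u2)); auto; lra.
Qed.

Lemma displacing_sequence : exists xs : nat -> R -> R,
  (forall n, G (xs n)) /\ (forall n, displaces (xs (S n)) (xs n)) /\
  exists t, xs O t <> t.
Proof.
  set (St := (((R -> R) -> Prop) * list (R * R) * (R * R -> R * R) * (R -> R))%type).
  set (ok := fun s : St => let '(Z, L, F, x) := s in stable Z L F x).
  assert (step : forall s : {s | ok s}, exists s' : {s | ok s},
    displaces (snd (proj1_sig s')) (snd (proj1_sig s)) /\
    exists t, snd (proj1_sig s') t <> t).
  { intros [[[[Z L] F] x] Hs]. destruct (stable_step Z L F x Hs) as [Z' [L' [F' [x' [H' D]]]]].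
    exists (exist _ (Z', L', F', x') H'). exact D. }
  set (next := fun s => proj1_sig (constructive_indefinite_description _ (step s))).
  assert (Hnext := fun s => proj2_sig (constructive_indefinite_description _ (step s))).
  change (forall s, displaces (snd (proj1_sig (next s))) (snd (proj1_sig s)) /\
    exists t, snd (proj1_sig (next s)) t <> t) in Hnext.
  destruct GU as [Lu [Fv [Fw NU]]].
  (* The chain starts with [G], the single gap [(u1, u2)], a one-point interval and the identity. *)
  assert (s0 : {s | ok s}).
  { exists (G, (u1, u2) :: nil, (fun _ => ((u1 + u2) / 2, (u1 + u2) / 2)), (fun x => x)).
    split; [|split; [|split; [|split]]].
    - split; auto.
    - apply (grp_id _ GG).
    - simpl; auto.
    - intros t N. tauto.
    - intros V [<-|[]]. simpl. split; [|split; [|split; [|split]]]; auto.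
      + lra.
      + intros t _ N. tauto.
      + intros Z' [_ [_ NZ']] _ T. apply (NZ' ((u1 + u2) / 2)). lra.
        intros z Zz. apply T; auto. lra. }
  (* The shift of the index drops the initial identity, so that [xs O] is nontrivial. *)
  exists (fun n => snd (proj1_sig (Nat.iter (S n) next s0))). split; [|split].
  - intros n. destruct (Nat.iter (S n) next s0) as [[[[Z L] F] x] Hs].
    simpl. destruct Hs as [[_ [SZ _]] [Zx _]]. auto.
  - intros n. apply (Hnext (Nat.iter (S n) next s0)).
  - apply (Hnext s0).
Qed.

End Interval.

(** * Generated subgroups and nested orbitals *)

Inductive gen (S : (R -> R) -> Prop) : (R -> R) -> Prop :=
| gen_one : gen S (fun x => x)
| gen_in f : S f -> gen S f
| gen_comp f g : gen S f -> gen S g -> gen S (fun x => f (g x))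
| gen_inverse f f' : gen S f -> inv2 f f' -> gen S f'.

Lemma gen_sub S H : grp H -> (forall f, S f -> H f) -> forall f, gen S f -> H f.
Proof.
  intros G SH f Gf. induction Gf; auto.
  - apply (grp_id _ G).
  - apply (grp_mul _ G); auto.
  - eapply grp_inv_in; eauto.
Qed.

Lemma gen_grp S H : grp H -> (forall f, S f -> H f) -> grp (gen S).
Proof.
  intros G SH. constructor.
  - apply gen_one.
  - apply gen_comp.
  - intros f Gf. destruct (grp_inv _ G f) as [f' [_ I]]. apply (gen_sub S); auto.
    exists f'. split; auto. eapply gen_inverse; eauto.
  - intros f Gf. apply (grp_pl _ G), (gen_sub S); auto.
Qed.

Lemma gen_fixed (S : (R -> R) -> Prop) e : (forall f, S f -> f e = e) -> fixedby (gen S) e.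
Proof.
  intros F f Gf. induction Gf; auto.
  - congruence.
  - eapply inv2_fix; eauto.
Qed.

(* On points fixed by [core Y] the group [Y] acts through an abelian quotient. *)
Lemma commute_on_core_fixed Y f g e : grp Y -> Y f -> Y g -> fixedby (core Y) e ->
  f (g e) = g (f e).
Proof.
  intros G Yf Yg Fe.
  destruct (grp_inv _ G f Yf) as [f' [Yf' If]]. destruct (grp_inv _ G g Yg) as [g' [Yg' Ig]].
  assert (E := Fe _ (core_commutator Y f' g' f g G Yf' Yg' (inv2_sym _ _ If) (inv2_sym _ _ Ig))).
  cbv beta in E. apply (f_equal f) in E. rewrite (proj2 If) in E.
  apply (f_equal g) in E. rewrite (proj2 Ig) in E. exact E.
Qed.

(* An end [c] of the orbital [(a, b)] of [f] lies in [(a', b')] and is fixed by [core Y];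
   the translates of [c] and [e] under [g] accumulate at [b'], where they alternate
   between points fixed and points moved by [f], so [f] has no affine germ there. *)
Lemma core_moves_nested Y f g a b a' b' e : grp Y -> Y f -> Y g ->
  f a = a -> f b = b -> (forall t, a < t < b -> f t <> t) ->
  g a' = a' -> g b' = b' -> (forall t, a' < t < b' -> g t <> t) ->
  a' <= a -> b <= b' -> a' < a \/ b < b' -> a < e < b -> ~ fixedby (core Y) e.
Proof.
  intros G Yf Yg Fa Fb Nf Ga Gb Ng La Lb Lab He Fe.
  assert (Pf := grp_pl _ G f Yf).
  destruct (grp_inv _ G f Yf) as [f' [Yf' If]].
  assert (GC := core_grp Y G). assert (NC := core_normal Y G).
  assert (X : exists c, a' < c < b' /\ f c = c /\ fixedby (core Y) c).
  (* If the core moved [c], the ends of its gap around [c] would be fixed by [f]. The gap avoids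
     [e], so one of these ends would lie in [(a, b)], where [f] moves everything. *)
  { assert (K : forall c, f c = c -> a <= c <= b -> fixedby (core Y) c).
    { intros c Fc Rc. apply NNPP. intros N.
      destruct (grp_gap (core Y) c GC N) as [v [w [Hc [L [Fv [Fw Nvw]]]]]].
      assert (Hf : forall k, Y k -> k c = c -> k v <= v /\ w <= k w).
      { intros k Yk kc. assert (Pk := grp_pl _ G k Yk).
        assert (A := pl_inc _ Pk v c ltac:(lra)). assert (B := pl_inc _ Pk c w ltac:(lra)).
        rewrite kc in A, B. split.
        - destruct (Rlt_le_dec v (k v)); auto. exfalso.
          apply (Nvw (k v)). lra. apply (normal_fixed _ Y); auto.
        - destruct (Rlt_le_dec (k w) w); auto. exfalso.
          apply (Nvw (k w)). lra. apply (normal_fixed _ Y); auto. }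
      destruct (Hf f Yf Fc) as [A B]. destruct (Hf f' Yf' (inv2_fix f f' c If Fc)) as [A' B'].
      apply (pl_le f) in A'; auto. apply (pl_le f) in B'; auto.
      rewrite (proj2 If) in A', B'.
      assert (c <> e) by (intros ->; auto).
      destruct (Rlt_le_dec e c) as [M|M].
      - assert (e <= v) by (destruct (Rlt_le_dec v e); auto; exfalso; apply (Nvw e); auto; lra).
        apply (Nf v); lra.
      - assert (w <= e) by (destruct (Rlt_le_dec e w); auto; exfalso; apply (Nvw e); auto; lra).
        apply (Nf w); lra. }
    destruct Lab; [exists a | exists b]; repeat split; auto; try lra; apply K; auto; lra. }
  destruct X as [c [Hc [Fc FCc]]].
  set (T := gen (fun k => k = g)).
  assert (TY : forall k, T k -> Y k) by (apply gen_sub; auto; intros k ->; auto).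
  assert (GT : grp T) by (apply (gen_grp _ Y); auto; intros k ->; auto).
  assert (GP : gap T a' b').
  { repeat split; try (apply gen_fixed; intros k ->; auto).
    - lra.
    - intros t Ht F. apply (Ng t Ht). apply F. apply gen_in; auto. }
  destruct (pl_germ _ Pf b' (- 1)) as [d [p [q [D Lin]]]]; auto.
  destruct (orbit_right T a' b' c (b' - d)) as [k1 [Tk1 L1]]; auto; try lra.
  assert (R1 := gap_stable T a' b' k1 c GT GP Tk1 Hc).
  destruct (orbit_right T a' b' c (k1 c)) as [k2 [Tk2 L2]]; auto; try lra.
  assert (R2 := gap_stable T a' b' k2 c GT GP Tk2 Hc).
  destruct (orbit_right T a' b' e (b' - d)) as [k3 [Tk3 L3]]; auto; try lra.
  assert (R3 := gap_stable T a' b' k3 e GT GP Tk3 ltac:(lra)).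
  assert (E1 : f (k1 c) = k1 c) by (rewrite (commute_on_core_fixed Y f k1), Fc; auto).
  assert (E2 : f (k2 c) = k2 c) by (rewrite (commute_on_core_fixed Y f k2), Fc; auto).
  assert (E3 : f (k3 e) <> k3 e).
  { rewrite (commute_on_core_fixed Y f k3); auto. intros E.
    apply (pl_inj k3) in E; [|apply (grp_pl _ G); auto]. apply (Nf e); auto. }
  rewrite Lin in E1, E2, E3 by lra.
  (* Two fixed points on one affine piece force slope 1 and constant term 0, so [f] would fix [k3 e]
     as well. *)
  assert (p = 1).
  { apply Rmult_eq_reg_r with (k2 c - k1 c); lra. }
  subst p. apply E3. lra.
Qed.

(** By [core_moves_nested] the core of [K] has no fixed point in any orbital of the tower. Hence it
    has none between the common point [m] and any [k m], and the orbit of [m] under [K] approaches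
    both ends of the gap. *)
Lemma tower_interval H (g : nat -> R -> R) (a b : nat -> R) : grp H ->
  (forall n, H (g n)) -> (forall n, g n (a n) = a n) -> (forall n, g n (b n) = b n) ->
  (forall n, a n < b n) -> (forall n t, a n < t < b n -> g n t <> t) ->
  (forall n, a (S n) <= a n) -> (forall n, b n <= b (S n)) ->
  (forall n, a (S n) < a n \/ b n < b (S n)) ->
  exists G u1 u2, grp G /\ (forall f, G f -> H f) /\ gap G u1 u2 /\
    forall f, G f -> inner u1 u2 f.
Proof.
  intros GH Hg Ha Hb Lab Ng La Lb Lne.
  set (K := gen (fun f => exists n, f = g n)).
  assert (SK : forall f, (exists n, f = g n) -> H f) by (intros f [n ->]; auto).
  assert (GK : grp K) by (apply (gen_grp _ H); auto).
  assert (Kg : forall n, K (g n)) by (intros n; apply gen_in; eauto).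
  assert (GC := core_grp K GK). assert (NC := core_normal K GK).
  assert (A0 : forall n, a n <= a O /\ b O <= b n).
  { induction n as [|n IH]; [lra|]. specialize (La n). specialize (Lb n). lra. }
  assert (NF : forall n e, a n < e < b n -> ~ fixedby (core K) e).
  { intros n e He. apply (core_moves_nested K (g n) (g (S n)) (a n) (b n) (a (S n)) (b (S n)));
      auto. }
  set (m := (a O + b O) / 2).
  assert (Hm : forall n, a n < m < b n).
  { intros n. specialize (A0 n). specialize (Lab O). unfold m. lra. }
  destruct (grp_gap K m GK) as [u1 [u2 [Hu GU]]].
  { intros F. apply (Ng O m (Hm O)). apply F; auto. }
  set (near := fun x y => forall z, x <= z <= y \/ y <= z <= x -> ~ fixedby (core K) z).
  assert (near_trans : forall x y z, near x y -> near y z -> near x z).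
  { intros x y z A B s [Hs|Hs]; destruct (Rle_lt_dec s y).
    - apply A; lra.
    - apply B; lra.
    - apply B; lra.
    - apply A; lra. }
  assert (near_sym : forall x y, near x y -> near y x) by (intros x y A s Hs; apply A; tauto).
  assert (near_map : forall k x y, K k -> near x y -> near (k x) (k y)).
  { intros k x y Kk A s Hs F. destruct (grp_inv _ GK k Kk) as [k' [Kk' I]].
    apply (A (k' s)).
    - destruct Hs as [Hs|Hs]; [left|right]; split; apply (pl_le_inv k);
        try (apply (grp_pl _ GK); auto); rewrite (proj2 I); lra.
    - apply (normal_fixed _ K); auto. }
  (* Induction on the word [k]: for a generator, [m] and its image lie in the same orbital. *)
  assert (Hnear : forall k, K k -> near m (k m)).
  { intros k Kk. induction Kk as [|k [n ->]|k1 k2 K1 IH1 K2 IH2|k k' Kk IH I].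
    - intros s Hs. apply (NF O). specialize (Hm O). lra.
    - intros s Hs. apply (NF n). assert (P := grp_pl _ GK _ (Kg n)).
      assert (A := pl_inc _ P (a n) m ltac:(apply Hm)). rewrite Ha in A.
      assert (B := pl_inc _ P m (b n) ltac:(apply Hm)). rewrite Hb in B.
      specialize (Hm n). lra.
    - apply near_trans with (k1 m); auto.
    - apply near_sym. rewrite <- (proj1 I m) at 2. apply near_map; auto.
      eapply grp_inv_in; eauto. }
  exists (core K), u1, u2. split; [|split; [|split]]; auto.
  - intros f [Kf _]. apply (gen_sub _ H GH SK); auto.
  - assert (GU' := GU). destruct GU as [L [F1 [F2 _]]]. repeat split; auto.
    + intros f [Kf _]; auto.
    + intros f [Kf _]; auto.
    + intros z Hz Fz.
      destruct (orbit_right K u1 u2 m z) as [k [Kk Lk]]; auto; [lra|].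
      destruct (orbit_left K u1 u2 m z) as [j [Kj Lj]]; auto; [lra|].
      destruct (Rlt_le_dec z m).
      * apply (Hnear j Kj z); auto. lra.
      * apply (Hnear k Kk z); auto. lra.
  - intros f Cf. apply (core_inner K); auto.
Qed.

(** * From [PLo], orbitals and towers to increasing maps and intervals *)

Lemma PLo_plmap f : PLo f -> plmap f.
Proof.
  intros [Out [F0 [F1 [Inc [_ [_ [n [x [a [b [X0 [X1 [Xinc Lin]]]]]]]]]]]]].
  assert (Hout : forall t, t <= 0 \/ 1 <= t -> f t = t).
  { intros t [[]|[]]; subst; auto; apply Out; unfold unitI; lra. }
  assert (Rng : forall t, 0 < t < 1 -> 0 < f t < 1).
  { intros t Ht. assert (A := Inc 0 t). assert (B := Inc t 1). unfold unitI in *. lra. }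
  assert (Mono : forall i, (i <= n)%nat -> 0 <= x i).
  { induction i as [|i IH]; intros Hi; [lra|]. specialize (Xinc i Hi).
    specialize (IH ltac:(lia)). lra. }
  (* Half-open pieces: closed on the left for right germs, closed on the right in [CovL] for left
     germs. *)
  assert (Cov : forall m e, (m <= n)%nat -> 0 <= e < x m ->
            exists i, (i < m)%nat /\ x i <= e < x (S i)).
  { induction m as [|m IH]; intros e Hm He; [lra|].
    destruct (Rlt_le_dec e (x m)).
    - destruct (IH e) as [i [Hi Hx]]; [lia|lra|]. exists i. split; auto.
    - exists m. split; auto. lra. }
  assert (CovL : forall m e, (m <= n)%nat -> 0 < e <= x m ->
            exists i, (i < m)%nat /\ x i < e <= x (S i)).
  { induction m as [|m IH]; intros e Hm He; [lra|].
    destruct (Rle_lt_dec e (x m)).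
    - destruct (IH e) as [i [Hi Hx]]; [lia|lra|]. exists i. split; auto.
    - exists m. split; auto. lra. }
  constructor; auto.
  - intros s t L.
    destruct (Rlt_le_dec 0 s); destruct (Rlt_le_dec s 1);
    destruct (Rlt_le_dec 0 t); destruct (Rlt_le_dec t 1); try lra;
    try (apply Inc; unfold unitI; lra);
    repeat match goal with
    | A : 0 < ?z, B : ?z < 1 |- _ => assert (0 < f z < 1) by (apply Rng; lra); clear A
    end; rewrite ?Hout with (t := s) by lra; rewrite ?Hout with (t := t) by lra; try lra.
  - intros e c [->| ->].
    + destruct (Rlt_le_dec e 0) as [K|K].
      { exists (- e), 1, 0. split; [lra|]. intros t Ht. rewrite Hout; lra. }
      destruct (Rlt_le_dec e 1) as [K1|K1].
      * destruct (Cov n e) as [i [Hi Hx]]; [lia|lra|].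
        exists (x (S i) - e), (a i), (b i). split; [lra|]. intros t Ht. apply Lin; auto. lra.
      * exists 1, 1, 0. split; [lra|]. intros t Ht. rewrite Hout; lra.
    + destruct (Rlt_le_dec 1 e) as [K|K].
      { exists (e - 1), 1, 0. split; [lra|]. intros t Ht. rewrite Hout; lra. }
      destruct (Rlt_le_dec 0 e) as [K1|K1].
      * destruct (CovL n e) as [i [Hi Hx]]; [lia|lra|].
        exists (e - x i), (a i), (b i). split; [lra|]. intros t Ht. apply Lin; auto. lra.
      * exists 1, 1, 0. split; [lra|]. intros t Ht. rewrite Hout; lra.
Qed.

Lemma subgroup_grp H : is_subgroup_PLo H -> grp H.
Proof.
  intros [HP [H1 [HM HI]]]. constructor; auto.
  - intros f g Hf Hg. exact (HM g f Hg Hf).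
  - intros f Hf. destruct (HI f Hf) as [f' [Hf' [E1 E2]]]. exists f'. split; auto.
    split; intros x; [exact (f_equal (fun k => k x) E1) | exact (f_equal (fun k => k x) E2)].
  - intros f Hf. apply PLo_plmap; auto.
Qed.

(** Convexity keeps the orbital between the ends of the gap of [f] around one of its points, and
    maximality makes it the whole gap. *)
Lemma orbital_ends f f' A : plmap f -> inv2 f f' -> orbital f A -> exists v w,
  v < w /\ f v = v /\ f w = w /\ (forall t, v < t < w -> f t <> t) /\
  forall t, A t <-> v < t < w.
Proof.
  intros P I [[e Ae] [Mv [Cn Mx]]].
  destruct (gap_exists (fun k => k = f) e) as [v [w [He [V0 [W1 [L [Fv [Fw N]]]]]]]].
  { intros k ->. eauto. }
  { intros F. apply (proj2 (Mv e Ae)). apply F; auto. }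
  assert (Fv' := Fv f eq_refl). assert (Fw' := Fw f eq_refl).
  exists v, w. split; [|split; [|split; [|split]]]; auto.
  { intros t Ht E. apply (N t Ht). intros k ->. auto. }
  assert (S1 : forall t, A t -> v < t < w).
  { intros t At.
    assert (NI : forall s, f s = s -> ~ A s) by (intros s E As; apply (proj2 (Mv s As)); auto).
    split.
    - destruct (Rlt_le_dec v t); auto. exfalso. apply (NI v Fv'). apply (Cn t e v); auto; lra.
    - destruct (Rlt_le_dec t w); auto. exfalso. apply (NI w Fw'). apply (Cn e t w); auto; lra. }
  intros t. split; auto. apply (Mx (fun t => v < t < w)).
  - intros x y z Hx Hy Hz. lra.
  - intros s Hs. split. unfold unitI. lra. intros E. apply (N s Hs). intros k ->. auto.
  - exact S1.
Qed.

Lemma tall_tower_interval H : grp H -> admits_tall_tower H ->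
  exists G u1 u2, grp G /\ (forall f, G f -> H f) /\ gap G u1 u2 /\
    forall f, G f -> inner u1 u2 f.
Proof.
  intros GH [T [[TS [TD TC]] [s [sT [sI sL]]]]].
  assert (E : forall n, exists p : R * R, fst p < snd p /\
     snd (s n) (fst p) = fst p /\ snd (s n) (snd p) = snd p /\
     (forall t, fst p < t < snd p -> snd (s n) t <> t) /\
     forall t, fst (s n) t <-> fst p < t < snd p).
  { intros n. destruct (TS _ (sT n)) as [Hn On].
    destruct (grp_inv _ GH _ Hn) as [f' [_ I]].
    destruct (orbital_ends _ f' _ (grp_pl _ GH _ Hn) I On) as [v [w K]]. exists (v, w). auto. }
  set (p := fun n => proj1_sig (constructive_indefinite_description _ (E n))).
  assert (Hp := fun n => proj2_sig (constructive_indefinite_description _ (E n))).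
  fold p in Hp.
  change (forall n, fst (p n) < snd (p n) /\
     snd (s n) (fst (p n)) = fst (p n) /\ snd (s n) (snd (p n)) = snd (p n) /\
     (forall t, fst (p n) < t < snd (p n) -> snd (s n) t <> t) /\
     forall t, fst (s n) t <-> fst (p n) < t < snd (p n)) in Hp.
  clearbody p.
  assert (Sub : forall n t, fst (p n) < t < snd (p n) -> fst (p (S n)) < t < snd (p (S n))).
  { intros n t Ht. apply Hp. apply (sL n (S n)); auto. apply Hp; auto. }
  assert (L1 : forall n, fst (p (S n)) <= fst (p n)).
  { intros n. destruct (Hp n) as [L _].
    destruct (Rlt_le_dec (fst (p n)) (fst (p (S n)))) as [K|]; auto. exfalso.
    assert (A := Rmin_l (fst (p (S n))) (snd (p n))). assert (B := Rmin_r (fst (p (S n))) (snd (p n))).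
    assert (C : fst (p n) < Rmin (fst (p (S n))) (snd (p n))) by (apply Rmin_glb_lt; auto).
    assert (D := Sub n ((fst (p n) + Rmin (fst (p (S n))) (snd (p n))) / 2)). lra. }
  assert (L2 : forall n, snd (p n) <= snd (p (S n))).
  { intros n. destruct (Hp n) as [L _].
    destruct (Rlt_le_dec (snd (p (S n))) (snd (p n))) as [K|]; auto. exfalso.
    assert (A := Rmax_l (snd (p (S n))) (fst (p n))). assert (B := Rmax_r (snd (p (S n))) (fst (p n))).
    assert (C : Rmax (snd (p (S n))) (fst (p n)) < snd (p n)) by (apply Rmax_lub_lt; auto).
    assert (D := Sub n ((snd (p n) + Rmax (snd (p (S n))) (fst (p n))) / 2)). lra. }
  apply (tower_interval H (fun n => snd (s n)) (fun n => fst (p n)) (fun n => snd (p n)));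
    auto; try solve [intros n; destruct (Hp n) as [? [? [? [? _]]]]; assumption].
  - intros n. apply (TS _ (sT n)).
  (* Equal ends would give equal orbitals, excluded for distinct members of a tower. *)
  - intros n. apply NNPP. intros N. specialize (L1 n). specialize (L2 n).
    apply (TD (s n) (s (S n))); auto.
    + intros Es. apply sI in Es. lia.
    + intros t. rewrite (proj2 (proj2 (proj2 (proj2 (Hp n)))) t).
      rewrite (proj2 (proj2 (proj2 (proj2 (Hp (S n))))) t).
      apply not_or_and in N as [N1 N2].
      rewrite (Rle_antisym _ _ L1 (Rnot_lt_le _ _ N1)).
      rewrite (Rle_antisym _ _ L2 (Rnot_lt_le _ _ N2)). tauto.
Qed.

(** * Integer powers *)

Definition finv (f : R -> R) (y : R) : R := epsilon (inhabits 0) (fun x => f x = y).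

(** Negative powers need an inverse that is a function of [f]; [finv] chooses preimages and is a
    true inverse once some [f'] is. *)
Definition zpow (f : R -> R) (n : Z) : R -> R :=
  if (0 <=? n)%Z then Nat.iter (Z.to_nat n) f else Nat.iter (Z.to_nat (- n)) (finv f).

Lemma finv_inv2 f f' : inv2 f f' -> inv2 f (finv f).
Proof.
  intros I. assert (A : forall y, f (finv f y) = y).
  { intros y. apply (epsilon_spec (inhabits 0) (fun x => f x = y)).
    exists (f' y). apply (proj2 I). }
  split; auto. intros x. rewrite <- (proj1 I (finv f (f x))), A. apply (proj1 I).
Qed.

Lemma zpow_succ f n x : inv2 f (finv f) -> zpow f (n + 1) x = f (zpow f n x).
Proof.
  intros I. unfold zpow. destruct (Z.leb_spec 0 n); destruct (Z.leb_spec 0 (n + 1)); try lia.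
  - replace (Z.to_nat (n + 1)) with (S (Z.to_nat n)) by lia. reflexivity.
  - replace n with (-1)%Z by lia. simpl. symmetry. apply (proj2 I).
  - replace (Z.to_nat (- n)) with (S (Z.to_nat (- (n + 1)))) by lia.
    symmetry. apply (proj2 I).
Qed.

Lemma zpow_add f n m x : inv2 f (finv f) -> zpow f (n + m) x = zpow f n (zpow f m x).
Proof.
  intros I. revert n. apply Z.peano_ind.
  - reflexivity.
  - intros n IH. replace (Z.succ n + m)%Z with (n + m + 1)%Z by lia.
    replace (Z.succ n) with (n + 1)%Z by lia. rewrite !zpow_succ, IH; auto.
  - intros n IH.
    rewrite <- (proj1 I (zpow f (Z.pred n + m) x)), <- (proj1 I (zpow f (Z.pred n) _)).
    f_equal. rewrite <- !zpow_succ by auto.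
    replace (Z.pred n + m + 1)%Z with (n + m)%Z by lia.
    replace (Z.pred n + 1)%Z with n by lia. auto.
Qed.

Lemma zpow_fixed f n x : inv2 f (finv f) -> f x = x -> zpow f n x = x.
Proof.
  intros I F.
  assert (K : forall g m, g x = x -> Nat.iter m g x = x).
  { intros g m Eg. induction m as [|m IH]; auto. simpl. rewrite IH; auto. }
  assert (Fi := inv2_fix _ _ x I F). unfold zpow. destruct (0 <=? n)%Z; auto.
Qed.

Lemma zpow_in Y f n : grp Y -> Y f -> Y (zpow f n).
Proof.
  intros G Yf. destruct (grp_inv _ G f Yf) as [f' [Yf' I]].
  assert (Yi := grp_inv_in Y f _ G Yf (finv_inv2 f f' I)).
  assert (K : forall g m, Y g -> Y (Nat.iter m g)).
  { intros g m Yg. induction m as [|m IH]; [apply (grp_id _ G)|].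
    exact (grp_mul _ G g (Nat.iter m g) Yg IH). }
  unfold zpow. destruct (0 <=? n)%Z; auto.
Qed.

(** * The wreath product by a displacing element *)

Section Wreath.

Variable H : (R -> R) -> Prop.
Hypothesis GH : grp H.

(* The base group of the wreath product acts coordinatewise: on the translate of the
   support of [s] under [t ^ (- i)] as the conjugate of [phi (f i)] by [t ^ i]. *)
Definition base_action {A : Type} (s t : R -> R) (phi : A -> R -> R) (f : Z -> A) (z : R) : R :=
  epsilon (inhabits 0) (fun y =>
    (exists i, s (zpow t i z) <> zpow t i z /\ y = zpow t (- i) (phi (f i) (zpow t i z))) \/
    (forall i, s (zpow t i z) = zpow t i z) /\ y = z).

Section Base.

Variables s t : R -> R.
Hypothesis Ht : H t.
Hypothesis Hs : displaces t s.

Lemma t_inv : inv2 t (finv t).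
Proof. destruct (grp_inv _ GH t Ht) as [t' [_ I]]. eapply finv_inv2; eauto. Qed.

Lemma zpow_opp n z : zpow t (- n) (zpow t n z) = z.
Proof. rewrite <- zpow_add by apply t_inv. rewrite Z.add_opp_diag_l. reflexivity. Qed.

Lemma zpow_opp_r n z : zpow t n (zpow t (- n) z) = z.
Proof. rewrite <- zpow_add by apply t_inv. rewrite Z.add_opp_diag_r. reflexivity. Qed.

(** For negative [n], if [s] moved both [z] and [t ^ n z], the positive power [t ^ (- n)] would fail
    to displace the latter. *)
Lemma zpow_displaces n z : s z <> z -> n <> 0%Z -> s (zpow t n z) = zpow t n z.
Proof.
  intros Nz Nn.
  assert (Pos : forall m z, s z <> z -> (0 < m)%Z -> s (zpow t m z) = zpow t m z).
  { intros m y Ny Hm. unfold zpow. destruct (Z.leb_spec 0 m); [|lia].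
    destruct (Z.to_nat m) as [|k] eqn:E; [lia|]. apply Hs; auto. }
  destruct (Z.lt_total 0 n) as [K|[K|K]]; [auto | congruence |].
  apply NNPP. intros N. apply Nz. rewrite <- (zpow_opp n z). apply Pos; auto. lia.
Qed.

Lemma translates_disjoint i j z : s (zpow t i z) <> zpow t i z ->
  s (zpow t j z) <> zpow t j z -> i = j.
Proof.
  intros Ni Nj. apply NNPP. intros NE. apply Nj.
  replace j with ((j - i) + i)%Z by lia. rewrite zpow_add by apply t_inv.
  apply zpow_displaces; auto. lia.
Qed.

Lemma base_action_in {A : Type} (phi : A -> R -> R) f z i :
  s (zpow t i z) <> zpow t i z ->
  base_action s t phi f z = zpow t (- i) (phi (f i) (zpow t i z)).
Proof.
  intros Ni. unfold base_action.
  match goal with |- epsilon ?i ?P = _ => assert (E := epsilon_spec i P) end.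
  destruct E as [[j [Nj ->]]|[N _]].
  - eauto.
  - rewrite (translates_disjoint i j z Ni Nj). reflexivity.
  - exfalso. apply Ni, N.
Qed.

Lemma base_action_out {A : Type} (phi : A -> R -> R) f z :
  (forall i, s (zpow t i z) = zpow t i z) -> base_action s t phi f z = z.
Proof.
  intros N. unfold base_action.
  match goal with |- epsilon ?i ?P = _ => assert (E := epsilon_spec i P) end.
  destruct E as [[j [Nj _]]|[_ E]]; eauto. exfalso. apply Nj, N.
Qed.

Lemma in_translate_dec z : (exists i, s (zpow t i z) <> zpow t i z) \/
  forall i, s (zpow t i z) = zpow t i z.
Proof.
  destruct (classic (exists i, s (zpow t i z) <> zpow t i z)) as [E|N]; auto.
  right. intros i. apply NNPP. eauto.
Qed.

Variable A : RawGroup.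
Variable phi : car A -> R -> R.

(** The induction hypothesis for the tower of wreath products. [emb_supp] lets the conjugates by
    powers of [t] act independently; the last three fields supply what group axioms would give, as
    [RawGroup] carries none. *)
Record embeds : Prop := {
  emb_in : forall x, valid A x -> H (phi x);
  emb_mul : forall x y, valid A x -> valid A y -> phi (mul A x y) = plmul (phi x) (phi y);
  emb_inj : forall x y, valid A x -> valid A y -> phi x = phi y -> x = y;
  emb_supp : forall x z, valid A x -> s z = z -> phi x z = z;
  emb_one_valid : valid A (one A);
  emb_one : forall z, phi (one A) z = z;
  emb_mul_valid : forall x y, valid A x -> valid A y -> valid A (mul A x y) }.

Hypothesis E : embeds.

Lemma emb_moves x z : valid A x -> s z <> z -> s (phi x z) <> phi x z.
Proof.
  intros V N K. apply N. assert (K2 := emb_supp E x (phi x z) V K).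
  apply pl_inj in K2. rewrite K2 in K. auto. apply (grp_pl _ GH), (emb_in E); auto.
Qed.

Lemma base_action_moves f z i : (forall j, valid A (f j)) -> s (zpow t i z) <> zpow t i z ->
  s (zpow t i (base_action s t phi f z)) <> zpow t i (base_action s t phi f z).
Proof.
  intros V N. rewrite (base_action_in phi f z i N), zpow_opp_r. apply emb_moves; auto.
Qed.

Lemma base_action_mul f g z : (forall i, valid A (f i)) -> (forall i, valid A (g i)) ->
  base_action s t phi (fun i => mul A (f i) (g i)) z =
  base_action s t phi g (base_action s t phi f z).
Proof.
  intros Vf Vg. destruct (in_translate_dec z) as [[i Ni]|N].
  - rewrite (base_action_in phi g _ i) by (apply base_action_moves; auto).
    rewrite !(base_action_in phi _ z i Ni), zpow_opp_r, (emb_mul E) by auto. reflexivity.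
  - rewrite !(base_action_out phi _ z N). reflexivity.
Qed.

(** Conjugation by [t ^ n] shifts the coordinates, with the sign used in the product of [wrZ]. *)
Lemma base_action_shift f n z :
  base_action s t phi f (zpow t n z) = zpow t n (base_action s t phi (fun i => f (i - n)%Z) z).
Proof.
  destruct (in_translate_dec z) as [[i Ni]|N].
  - rewrite (base_action_in phi _ z i Ni).
    assert (K : zpow t (i - n) (zpow t n z) = zpow t i z).
    { rewrite <- zpow_add by apply t_inv. f_equal. lia. }
    rewrite (base_action_in phi f (zpow t n z) (i - n)) by (rewrite K; auto).
    rewrite K, <- zpow_add by apply t_inv. f_equal. lia.
  - rewrite (base_action_out phi _ z N), base_action_out; auto.
    intros i. rewrite <- zpow_add by apply t_inv. apply N.
Qed.

(** Finite support makes the action a finite product of conjugates of elements [phi (f i)] by powers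
    of [t]; the induction splits off one factor. *)
Lemma base_action_valid (l : list Z) : forall f, (forall i, valid A (f i)) ->
  (forall i, ~ In i l -> f i = one A) -> H (base_action s t phi f).
Proof.
  induction l as [|i l IH]; intros f Vf Of.
  - replace (base_action s t phi f) with (fun x : R => x). apply (grp_id _ GH).
    extensionality z. destruct (in_translate_dec z) as [[i Ni]|N].
    + rewrite (base_action_in phi f z i Ni), Of, (emb_one E); auto. symmetry. apply zpow_opp.
    + symmetry. apply base_action_out; auto.
  - set (f1 := fun j => if Z.eq_dec j i then one A else f j).
    assert (H1 : H (base_action s t phi f1)).
    { apply IH; intros j; unfold f1; destruct (Z.eq_dec j i); auto.
      - apply (emb_one_valid E).
      - intros Nj. apply Of. intros [|]; auto. }
    assert (H2 : H (fun z => zpow t (- i) (phi (f i) (zpow t i z)))).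
    { apply (grp_mul _ GH (zpow t (- i)) (fun z => phi (f i) (zpow t i z))).
      apply zpow_in; auto. apply (grp_mul _ GH); [apply (emb_in E); auto | apply zpow_in; auto]. }
    replace (base_action s t phi f) with
      (fun z => zpow t (- i) (phi (f i) (zpow t i (base_action s t phi f1 z)))).
    { exact (grp_mul _ GH _ _ H2 H1). }
    extensionality z. destruct (in_translate_dec z) as [[j Nj]|N].
    + rewrite (base_action_in phi f z j Nj). destruct (Z.eq_dec j i) as [->|NE].
      * f_equal. f_equal. rewrite (base_action_in phi f1 z i Nj). unfold f1.
        destruct (Z.eq_dec i i); [|congruence]. rewrite (emb_one E). apply zpow_opp_r.
      * assert (Nj' := base_action_moves f z j Vf Nj).
        assert (K : base_action s t phi f1 z = base_action s t phi f z).
        { rewrite !(base_action_in phi _ z j Nj). unfold f1.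
          destruct (Z.eq_dec j i); congruence. }
        (* The point stays in the translate of index [j], where the factor of index [i] is
           trivial. *)
        rewrite K, <- (base_action_in phi f z j Nj), (emb_supp E); auto using zpow_opp.
        apply NNPP. intros Ni. apply NE. apply (translates_disjoint _ _ _ Nj' Ni).
    + rewrite !(base_action_out phi _ z N), (emb_supp E); auto using zpow_opp.
Qed.

(** Base part first, then the power of [t], as [plmul] applies its left factor first. *)
Definition wreath_action (p : car (wrZ A)) (z : R) : R :=
  zpow t (snd p) (base_action s t phi (fst p) z).

Lemma finitely_supported_list (f : Z -> car A) (N : Z) :
  (forall i, (N < Z.abs i)%Z -> f i = one A) ->
  exists l : list Z, forall i, ~ In i l -> f i = one A.
Proof.
  intros HN. set (l := map Z.of_nat (seq 0 (S (Z.to_nat N)))).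
  exists (l ++ map Z.opp l). intros i Ni. apply HN.
  destruct (Z.lt_ge_cases N (Z.abs i)) as [|K]; auto. exfalso. apply Ni.
  assert (K2 : In (Z.abs i) l).
  { unfold l. rewrite <- (Z2Nat.id (Z.abs i)) by lia. apply in_map, in_seq. lia. }
  apply in_or_app. destruct (Z.abs_spec i) as [[_ Ei]|[_ Ei]]; rewrite Ei in K2; auto.
  right. rewrite <- (Z.opp_involutive i). apply in_map; auto.
Qed.

Lemma wreath_action_hom x y : valid (wrZ A) x -> valid (wrZ A) y ->
  wreath_action (mul (wrZ A) x y) = plmul (wreath_action x) (wreath_action y).
Proof.
  destruct x as [f n], y as [g m]. intros [Vf _] [Vg _]. simpl in *.
  extensionality z. unfold plmul, wreath_action. simpl.
  rewrite base_action_shift, (base_action_mul f (fun i => g (i - n)%Z)); auto.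
  rewrite <- zpow_add by apply t_inv. f_equal. lia.
Qed.

Lemma wreath_action_inj x y : (exists z, s z <> z) -> valid (wrZ A) x -> valid (wrZ A) y ->
  wreath_action x = wreath_action y -> x = y.
Proof.
  destruct x as [f n], y as [g m]. intros [z0 N0] [Vf _] [Vg _] EQ. simpl in *.
  assert (EZ : forall z, zpow t n (base_action s t phi f z) = zpow t m (base_action s t phi g z)).
  { intros z. exact (f_equal (fun k => k z) EQ). }
  (* Both base parts keep [z0] in the support of [s], while a nonzero power of [t] would take it
     out. *)
  assert (Enm : n = m).
  { apply NNPP. intros NE.
    apply (base_action_moves g z0 0%Z Vg N0). simpl.
    assert (K : base_action s t phi g z0 = zpow t (n - m) (base_action s t phi f z0)).
    { rewrite <- (zpow_opp m (base_action s t phi g z0)), <- EZ, <- zpow_add by apply t_inv.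
      f_equal. lia. }
    change (s (base_action s t phi g z0) = base_action s t phi g z0). rewrite K.
    apply zpow_displaces; [|lia]. exact (base_action_moves f z0 0%Z Vf N0). }
  subst m. f_equal. extensionality i. apply (emb_inj E); auto. extensionality z.
  destruct (classic (s z = z)) as [F|N].
  - rewrite !(emb_supp E); auto.
  (* [f i] and [g i] are read off on the translate of index [i]. *)
  - specialize (EZ (zpow t (- i) z)).
    rewrite <- (zpow_opp n (base_action s t phi f (zpow t (- i) z))) in EZ.
    apply (f_equal (zpow t (- n))) in EZ. rewrite !zpow_opp in EZ.
    rewrite !(base_action_in phi _ _ i), !zpow_opp_r in EZ by (rewrite zpow_opp_r; auto).
    apply (f_equal (zpow t i)) in EZ. rewrite !zpow_opp_r in EZ. exact EZ.
Qed.

Lemma wreath_action_base (a : car A) : valid A a ->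
  wreath_action (fun i => if Z.eq_dec i 0 then a else one A, 0%Z) = phi a.
Proof.
  intros Va. extensionality z. unfold wreath_action. simpl.
  change (base_action s t phi (fun i => if Z.eq_dec i 0 then a else one A) z = phi a z).
  destruct (in_translate_dec z) as [[i Ni]|N].
  - rewrite (base_action_in phi _ z i Ni). destruct (Z.eq_dec i 0) as [->|NE]; auto.
    rewrite (emb_one E), zpow_opp, (emb_supp E); auto.
    apply NNPP. intros K. apply NE. apply (translates_disjoint i 0 z); auto.
  - rewrite (base_action_out phi _ z N), (emb_supp E); auto. apply (N 0%Z).
Qed.

End Base.

Lemma wreath_embeds s t A phi : H t -> displaces t s -> (exists z, s z <> z) ->
  embeds s A phi -> embeds t (wrZ A) (wreath_action s t A phi).
Proof.
  intros Ht Hs N E. constructor.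
  - intros [f n] [Vf [M HM]]. simpl in *.
    destruct (finitely_supported_list A f M HM) as [l Hl].
    apply (grp_mul _ GH (zpow t n) (base_action s t phi f)).
    + apply zpow_in; auto.
    + apply (base_action_valid s t Ht Hs A phi E l); auto.
  - intros x y. apply wreath_action_hom; auto.
  - intros x y. apply wreath_action_inj; auto.
  - intros [f n] z [Vf _] Fz. simpl in *. unfold wreath_action. simpl.
    assert (Fn : forall i, zpow t i z = z) by (intros i; apply zpow_fixed; auto using t_inv).
    rewrite (base_action_out s t); auto. intros i. rewrite Fn.
    (* A point moved by [s] is displaced by [t], hence not fixed by it. *)
    apply NNPP. intros Nz. assert (K := Hs 0%nat z Nz). simpl in K.
    rewrite Fz in K. auto.
  - split; simpl. intros i; apply (emb_one_valid _ _ _ E). exists 0%Z. auto.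
  - intros z. unfold wreath_action. simpl.
    change (base_action s t phi (fun _ : Z => one A) z = z).
    destruct (in_translate_dec s t z) as [[i Ni]|Nz].
    + rewrite (base_action_in s t Ht Hs phi _ z i Ni), (emb_one _ _ _ E). apply zpow_opp; auto.
    + apply base_action_out; auto.
  - intros [f n] [g m] [Vf [M HM]] [Vg [M' HM']]. simpl in *. split.
    + intros i. apply (emb_mul_valid _ _ _ E); auto.
    (* [Z.abs n] accounts for the shift of [g]. The product of [one A] with itself is then computed
       through the injective [phi]. *)
    + exists (Z.abs M + Z.abs M' + Z.abs n)%Z. intros i Hi. rewrite HM, HM' by lia.
      assert (V1 := emb_one_valid _ _ _ E).
      apply (emb_inj _ _ _ E); [apply (emb_mul_valid _ _ _ E); auto | auto |].
      rewrite (emb_mul _ _ _ E) by auto.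
      extensionality z. unfold plmul. apply (emb_one _ _ _ E).
Qed.

(** A nontrivial increasing map has infinite order: iterates of a moved point stay on the side to
    which it first moves. *)
Lemma cyclic_embeds s : H s -> (exists z, s z <> z) -> embeds s Zgroup (fun n => zpow s n).
Proof.
  intros Hs [z0 N0]. assert (Ps := grp_pl _ GH s Hs). assert (I := t_inv s Hs).
  assert (It : forall k, (s z0 < z0 -> Nat.iter (S k) s z0 < z0) /\
                         (z0 < s z0 -> z0 < Nat.iter (S k) s z0)).
  { induction k as [|k [IH1 IH2]]; simpl in *; auto. split; intros L.
    - apply Rlt_trans with (s z0); auto. apply (pl_inc _ Ps); auto.
    - apply Rlt_trans with (s z0); auto. apply (pl_inc _ Ps); auto. }
  assert (Pos : forall n, (0 < n)%Z -> zpow s n z0 <> z0).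
  { intros n Hn. unfold zpow. destruct (Z.leb_spec 0 n); [|lia].
    destruct (Z.to_nat n) as [|k] eqn:E; [lia|]. destruct (It k). lra. }
  assert (Free : forall n m, (n < m)%Z -> zpow s n <> zpow s m).
  { intros n m L E. apply (Pos (m - n)%Z); [lia|].
    apply (pl_inj (zpow s n)). apply (grp_pl _ GH), zpow_in; auto.
    rewrite <- zpow_add by auto. replace (n + (m - n))%Z with m by lia.
    rewrite E. reflexivity. }
  constructor; simpl; auto.
  - intros n _. apply zpow_in; auto.
  - intros n m _ _. extensionality z. unfold plmul. rewrite Z.add_comm. apply zpow_add; auto.
  - intros n m _ _ E. destruct (Z.lt_total n m) as [K|[K|K]]; auto; exfalso; eapply Free; eauto.
  - intros n z _ Fz. apply zpow_fixed; auto.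
Qed.

End Wreath.

(** * Iterated wreath products and the conclusion *)

Fixpoint tower_action (xs : nat -> R -> R) (k : nat) : car (W k) -> R -> R :=
  match k return car (W k) -> R -> R with
  | O => fun n => zpow (xs O) n
  | S k' => wreath_action (xs k') (xs (S k')) (W k') (tower_action xs k')
  end.

Lemma displacing_sequence_wreath H xs : grp H -> (forall n, H (xs n)) ->
  (forall n, displaces (xs (S n)) (xs n)) -> (exists z, xs O z <> z) ->
  contains_Zwr_infty H.
Proof.
  intros GH Hx Hd N0.
  assert (Nn : forall n, exists z, xs n z <> z).
  { induction n as [|n [z Nz]]; auto. exists z. intros F. apply Nz.
    assert (K := Hd n O z Nz). simpl in K. rewrite F in K. auto. }
  assert (E : forall k, embeds H (xs k) (W k) (tower_action xs k)).
  { induction k as [|k IH]; [apply cyclic_embeds | apply wreath_embeds]; auto. }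
  exists (tower_action xs). split; [|split; [|split]].
  - intros k x V. apply (emb_in _ _ _ _ (E k)); auto.
  - intros k x y V V'. apply (emb_mul _ _ _ _ (E k)); auto.
  - intros k x y V V'. apply (emb_inj _ _ _ _ (E k)); auto.
  - intros k x V. apply (wreath_action_base H GH (xs k) (xs (S k)) (Hx (S k)) (Hd k) _ _ (E k)); auto.
Qed.

Theorem theorem7 (H : (R -> R) -> Prop) :
  is_subgroup_PLo H -> admits_tall_tower H -> contains_Zwr_infty H.
Proof.
  intros SH TH. assert (GH := subgroup_grp H SH).
  destruct (tall_tower_interval H GH TH) as [G [u1 [u2 [GG [GsubH [GU GI]]]]]].
  destruct (displacing_sequence G u1 u2 GG GU GI) as [xs [Gx [Dx Nx]]].
  apply (displacing_sequence_wreath H xs); auto.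
Qed.
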